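(* Let $R$ be a local Noetherian ring of dimension $d$ with maximal ideal $\mathfrak m$ and let $A$ be an $R$-algebra. If $d=0$, the following are equivalent: (i) $A$ is parasolid; (ii) $A\neq 0$; (iii) $\operatorname{Spec} A\neq\emptyset$. If $d=1$ and $x\in R$ is such that $V(x)=V(\mathfrak m)$, the following are equivalent: (i) $A$ is parasolid; (ii) $H^1_{\mathfrak m}(A)\neq 0$; (iii) $A\to A_x$ is not surjective (this means that $x^k\notin (x^{k+1})$ in $A$ for all $k\in\mathbb{N}$); (iv) $D(x)=D(\mathfrak m A)\subseteq\operatorname{Spec} A$ is not a closed subset. If $d=2$, the following are equivalent: (i) $A$ is parasolid; (ii) $H^2_{\mathfrak m}(A)\neq 0$; (iii) the open subscheme $D(\mathfrak m A)\subseteq\operatorname{Spec} A$ is not affine.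
   Context: All rings are commutative with $1$. Let $R$ be a Noetherian local ring of dimension $d$ with maximal ideal $\mathfrak{m}$. Elements $x_1,\ldots,x_d\in R$ are called parameters if $V(x_1,\ldots,x_d)=V(\mathfrak{m})$; they define, via Čech cohomology, a class $1/(x_1\cdots x_d)\in H^d_{\mathfrak m}(R)$, called a paraclass (for $d=0$ the only paraclass is $1\in R=H^0_{\mathfrak m}(R)$). For an $R$-algebra $A$, $H^d_{\mathfrak m}(A)$ is the local cohomology of $A$ as an $R$-module. $A$ is called parasolid if every paraclass $0\neq c\in H^d_{\mathfrak m}(R)$ has non-zero image in $H^d_{\mathfrak m}(A)$. For an ideal $J$ of $A$, $D(J)=\operatorname{Spec} A\setminus V(J)$. *)

(* Defs.v *)
From HB Require Import structures.
From mathcomp Require Import all_boot all_order all_algebra ring.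
From mathcomp Require Import ring_quotient generic_quotient.
From mathcomp Require Import all_classical topology.

(* Rings are [comPzRingType]s, so that the zero ring is allowed, and an
   R-algebra is a ring A with a ring morphism [phi : {rmorphism R -> A}] (the
   library's [comAlgType R] would force A to be nonzero). *)

Set Implicit Arguments.
Unset Strict Implicit.
Unset Printing Implicit Defensive.

Import GRing.Theory.

Local Open Scope classical_set_scope.
Local Open Scope ring_scope.
Local Open Scope quotient_scope.

Section Ideals.
Variable A : comPzRingType.
Implicit Types (I J P E : set A).

Definition is_ideal I : Prop :=
  [/\ I 0, forall a b, I a -> I b -> I (a + b) & forall a b, I b -> I (a * b)].

Definition ideal_gen E : set A :=
  [set a | forall I, is_ideal I -> E `<=` I -> I a].

Definition prime_ideal P : Prop :=
  [/\ is_ideal P, ~ P 1 & forall a b, P (a * b) -> P a \/ P b].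

Definition maximal_ideal I : Prop :=
  [/\ is_ideal I, ~ I 1 & forall J, is_ideal J -> I `<=` J -> J = I \/ J 1].

Definition noetherian : Prop :=
  forall I, is_ideal I -> exists s : seq A, I = ideal_gen [set` s].

Definition local_ring_with (m : set A) : Prop :=
  maximal_ideal m /\ forall n, maximal_ideal n -> n = m.

End Ideals.

Record Spec (A : comPzRingType) :=
  SpecPoint { point_ideal :> set A; point_prime : prime_ideal point_ideal }.

HB.instance Definition _ A := gen_eqMixin (Spec A).
HB.instance Definition _ A := gen_choiceMixin (Spec A).

Section Zariski.
Variable A : comPzRingType.

Definition zeros (E : set A) : set (Spec A) := [set p | E `<=` p].

Definition nonzeros (E : set A) : set (Spec A) := ~` zeros E.

Definition zariski_open (U : set (Spec A)) : Prop :=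
  exists E : set A, U = nonzeros E.

Lemma zariski_openT : zariski_open setT.
Proof.
exists setT; apply/seteqP; split=> // p _ /= h.
by case: (point_prime p) => _ p1 _; apply: p1; apply: h.
Qed.

Lemma zariski_openI : setI_closed zariski_open.
Proof.
move=> _ _ [E ->] [F ->].
exists [set x | exists e f, [/\ E e, F f & x = e * f]].
apply/seteqP; split=> p /=.
- move=> [hE hF] h; apply: hE => e Ee; apply: contrapT => ne.
  apply: hF => f Ff; case: (point_prime p) => _ _ /(_ e f) [] //.
  by apply: h; exists e, f.
- move=> h; case: (point_prime p) => -[_ _ pM] _ _; split=> hE; apply: h.
    by move=> _ [e [f [/hE ? _ ->]]]; rewrite mulrC; apply: pM.
  by move=> _ [e [f [_ /hE ? ->]]]; apply: pM.
Qed.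

Lemma zariski_open_bigU (I : Type) (f : I -> set (Spec A)) :
  (forall i, zariski_open (f i)) -> zariski_open (\bigcup_i f i).
Proof.
move=> /choice [E fE]; exists (\bigcup_i E i); apply/seteqP; split=> p /=.
- move=> [i _]; rewrite fE => h h'; apply: h => e Ee.
  by apply: h'; exists i.
- move=> h; apply: contrapT => h'; apply: h => e [i _ Ee].
  apply: contrapT => ne; apply: h'; exists i => //; rewrite fE => h.
  exact/ne/h.
Qed.

HB.instance Definition _ := isOpenTopological.Build (Spec A)
  zariski_openT zariski_openI zariski_open_bigU.

End Zariski.

(* [krull_dim A d]: d is the largest length of a chain of primes of A. *)
Definition prime_chain (A : comPzRingType) (n : nat) (p : 'I_n.+1 -> Spec A) :=
  forall i j : 'I_n.+1, (i < j)%N -> p i `<` p j.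

Definition krull_dim (A : comPzRingType) (d : nat) : Prop :=
  (exists p : 'I_d.+1 -> Spec A, prime_chain p) /\
  (forall n (p : 'I_n.+1 -> Spec A), prime_chain p -> (n <= d)%N).

Record mulSet (A : comPzRingType) := MulSet {
  mul_set :> set A;
  mul_set1 : mul_set 1;
  mul_setM : forall s t, mul_set s -> mul_set t -> mul_set (s * t) }.

Section Localization.
Variables (A : comPzRingType) (S : mulSet A).

Record preFrac := PreFrac { num : A; den : A; denP : mul_set S den }.

HB.instance Definition _ := gen_eqMixin preFrac.
HB.instance Definition _ := gen_choiceMixin preFrac.

Implicit Types x y z : preFrac.

Definition frac_eq x y : bool :=
  `[< exists2 u, mul_set S u & u * (num x * den y) = u * (num y * den x) >].

Lemma frac_eq_refl : reflexive frac_eq.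
Proof. by move=> x; apply/asboolP; exists 1 => //; apply: mul_set1. Qed.

Lemma frac_eq_sym : symmetric frac_eq.
Proof.
by move=> x y; apply/asboolP/asboolP => -[u Su e]; exists u.
Qed.

Lemma frac_eq_trans : transitive frac_eq.
Proof.
move=> y x z /asboolP [u Su e] /asboolP [v Sv f]; apply/asboolP.
exists (den y * (u * v)); first by do ![apply: mul_setM | exact: denP].
transitivity (v * den z * (u * (num x * den y))); first by ring.
rewrite e; transitivity (u * den x * (v * (num y * den z))); first by ring.
by rewrite f; ring.
Qed.

Canonical frac_eq_equiv :=
  EquivRel frac_eq frac_eq_refl frac_eq_sym frac_eq_trans.

(* The localization of A at S. *)
Definition loc := {eq_quot frac_eq}.

HB.instance Definition _ : EqQuotient _ frac_eq loc := EqQuotient.on loc.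
HB.instance Definition _ := Choice.on loc.

Definition mkfrac (a s : A) (Ss : mul_set S s) : loc := \pi_loc (PreFrac a Ss).

Lemma fracE (a s b t : A) (Ss : mul_set S s) (St : mul_set S t) :
  mkfrac a Ss = mkfrac b St <->
  exists2 u, mul_set S u & u * (a * t) = u * (b * s).
Proof.
split; first by move/eqmodP => /asboolP.
by move=> h; apply/eqmodP/asboolP.
Qed.

Lemma frac_surj (z : loc) : exists a s (Ss : mul_set S s), z = mkfrac a Ss.
Proof.
exists (num (repr z)), (den (repr z)), (denP (repr z)).
by rewrite /frac; case: (repr z) (reprK z).
Qed.

Definition loc0 : loc := mkfrac 0 (mul_set1 S).
Definition loc1 : loc := mkfrac 1 (mul_set1 S).

Definition loc_opp (z : loc) : loc := mkfrac (- num (repr z)) (denP (repr z)).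

Definition loc_add (z w : loc) : loc :=
  mkfrac (num (repr z) * den (repr w) + num (repr w) * den (repr z))
       (mul_setM (denP (repr z)) (denP (repr w))).

Definition loc_mul (z w : loc) : loc :=
  mkfrac (num (repr z) * num (repr w))
       (mul_setM (denP (repr z)) (denP (repr w))).

Lemma repr_frac (a s : A) (Ss : mul_set S s) :
  exists2 u, mul_set S u &
    u * (num (repr (mkfrac a Ss)) * s) = u * (a * den (repr (mkfrac a Ss))).
Proof. by have /eqmodP/asboolP := reprK (mkfrac a Ss). Qed.

Lemma frac_opp (a s : A) (Ss : mul_set S s) :
  loc_opp (mkfrac a Ss) = mkfrac (- a) Ss.
Proof.
apply/fracE; have [u Su e] := repr_frac a Ss; exists u => //.
by rewrite mulNr mulrN e mulNr mulrN.
Qed.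

Lemma frac_add (a s b t : A) (Ss : mul_set S s) (St : mul_set S t) :
  loc_add (mkfrac a Ss) (mkfrac b St) = mkfrac (a * t + b * s) (mul_setM Ss St).
Proof.
apply/fracE; have [u Su e] := repr_frac a Ss; have [v Sv f] := repr_frac b St.
exists (u * v); first exact: mul_setM.
set x := repr _ in e *; set y := repr _ in f *.
transitivity (v * t * den y * (u * (num x * s)) +
              u * s * den x * (v * (num y * t))); first by ring.
by rewrite e f; ring.
Qed.

Lemma frac_mul (a s b t : A) (Ss : mul_set S s) (St : mul_set S t) :
  loc_mul (mkfrac a Ss) (mkfrac b St) = mkfrac (a * b) (mul_setM Ss St).
Proof.
apply/fracE; have [u Su e] := repr_frac a Ss; have [v Sv f] := repr_frac b St.
exists (u * v); first exact: mul_setM.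
set x := repr _ in e *; set y := repr _ in f *.
transitivity (u * (num x * s) * (v * (num y * t))); first by ring.
by rewrite e f; ring.
Qed.

Lemma frac_congr (a s b t : A) (Ss : mul_set S s) (St : mul_set S t) :
  a * t = b * s -> mkfrac a Ss = mkfrac b St.
Proof. by move=> e; apply/fracE; exists 1; [exact: mul_set1 | rewrite e]. Qed.

Lemma loc_addA : associative loc_add.
Proof.
move=> x y z; have [a [s [Ss ->]]] := frac_surj x.
have [b [t [St ->]]] := frac_surj y; have [c [r [Sr ->]]] := frac_surj z.
by rewrite !frac_add; apply: frac_congr; ring.
Qed.

Lemma loc_addC : commutative loc_add.
Proof.
move=> x y; have [a [s [Ss ->]]] := frac_surj x.
have [b [t [St ->]]] := frac_surj y.
by rewrite !frac_add; apply: frac_congr; ring.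
Qed.

Lemma loc_add0 : left_id loc0 loc_add.
Proof.
move=> x; have [a [s [Ss ->]]] := frac_surj x.
by rewrite frac_add; apply: frac_congr; ring.
Qed.

Lemma loc_addN : left_inverse loc0 loc_opp loc_add.
Proof.
move=> x; have [a [s [Ss ->]]] := frac_surj x.
by rewrite frac_opp frac_add; apply: frac_congr; ring.
Qed.

HB.instance Definition _ :=
  GRing.isZmodule.Build loc loc_addA loc_addC loc_add0 loc_addN.

Lemma loc_mulA : associative loc_mul.
Proof.
move=> x y z; have [a [s [Ss ->]]] := frac_surj x.
have [b [t [St ->]]] := frac_surj y; have [c [r [Sr ->]]] := frac_surj z.
by rewrite !frac_mul; apply: frac_congr; ring.
Qed.

Lemma loc_mulC : commutative loc_mul.
Proof.
move=> x y; have [a [s [Ss ->]]] := frac_surj x.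
have [b [t [St ->]]] := frac_surj y.
by rewrite !frac_mul; apply: frac_congr; ring.
Qed.

Lemma loc_mul1 : left_id loc1 loc_mul.
Proof.
move=> x; have [a [s [Ss ->]]] := frac_surj x.
by rewrite frac_mul; apply: frac_congr; ring.
Qed.

Lemma loc_mulD : left_distributive loc_mul loc_add.
Proof.
move=> x y z; have [a [s [Ss ->]]] := frac_surj x.
have [b [t [St ->]]] := frac_surj y; have [c [r [Sr ->]]] := frac_surj z.
by rewrite !(frac_mul, frac_add); apply: frac_congr; ring.
Qed.

HB.instance Definition _ := GRing.Zmodule_isComPzRing.Build loc
  loc_mulA loc_mulC loc_mul1 loc_mulD.


Lemma locD (a s b t : A) (Ss : mul_set S s) (St : mul_set S t) :
  mkfrac a Ss + mkfrac b St = mkfrac (a * t + b * s) (mul_setM Ss St).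
Proof. exact: frac_add. Qed.

Lemma locN (a s : A) (Ss : mul_set S s) : - mkfrac a Ss = mkfrac (- a) Ss.
Proof. exact: frac_opp. Qed.

Lemma locM (a s b t : A) (Ss : mul_set S s) (St : mul_set S t) :
  mkfrac a Ss * mkfrac b St = mkfrac (a * b) (mul_setM Ss St).
Proof. exact: frac_mul. Qed.

Definition to_loc (a : A) : loc := mkfrac a (mul_set1 S).

End Localization.

(* [inverts phi S T]: the images under phi of the elements of S become
   invertible in the localization at T, so that phi induces a morphism
   [loc_map phi h : loc S -> loc T]; see [loc_mapE]. *)
Definition inverts (A B : comPzRingType) (phi : {rmorphism A -> B})
    (S : mulSet A) (T : mulSet B) : Prop :=
  forall s, mul_set S s -> exists b, mul_set T (phi s * b).

Section LocMap.
Variables (A B : comPzRingType) (phi : {rmorphism A -> B}).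
Variables (S : mulSet A) (T : mulSet B) (h : inverts phi S T).

Definition loc_map (z : loc S) : loc T :=
  let b := cid (h (denP (repr z))) in
  mkfrac (phi (num (repr z)) * sval b) (svalP b).

Lemma loc_mapE (a s : A) (Ss : mul_set S s) (b : B)
    (Tb : mul_set T (phi s * b)) :
  loc_map (mkfrac a Ss) = mkfrac (phi a * b) Tb.
Proof.
apply/fracE; have [u Su e] := repr_frac a Ss; have [c Tc] := h Su.
exists (phi u * c) => //; move: (cid _) => [b' /= _].
set x := repr _ in e *; move/(congr1 phi): e; rewrite !rmorphM => e.
transitivity (c * b * b' * (phi u * (phi (num x) * phi s))); first by ring.
by rewrite e; ring.
Qed.

Lemma loc_map_zmod : zmod_morphism loc_map.
Proof.
move=> x y; have [a [s [Ss ->]]] := frac_surj x.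
have [b [t [St ->]]] := frac_surj y.
have [c Tc] := h Ss; have [d Td] := h St.
have Tcd : mul_set T (phi (s * t) * (c * d)).
  by rewrite rmorphM mulrACA; apply: mul_setM.
rewrite (loc_mapE _ _ Tc) (loc_mapE _ _ Td) !locN !locD (loc_mapE _ _ Tcd).
by apply: frac_congr; rewrite !(rmorphM, rmorphD, rmorphN); ring.
Qed.

Lemma loc_map_monoid : monoid_morphism loc_map.
Proof.
split=> [|x y].
  have T1 : mul_set T (phi 1 * 1) by rewrite rmorph1 mulr1; apply: mul_set1.
  rewrite -[LHS]/(loc_map (mkfrac _ _)) (loc_mapE _ _ T1).
  by apply: frac_congr; rewrite rmorph1; ring.
have [a [s [Ss ->]]] := frac_surj x; have [b [t [St ->]]] := frac_surj y.
have [c Tc] := h Ss; have [d Td] := h St.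
have Tcd : mul_set T (phi (s * t) * (c * d)).
  by rewrite rmorphM mulrACA; apply: mul_setM.
rewrite (loc_mapE _ _ Tc) (loc_mapE _ _ Td) !locM (loc_mapE _ _ Tcd).
by apply: frac_congr; rewrite !rmorphM; ring.
Qed.

HB.instance Definition _ :=
  GRing.isZmodMorphism.Build (loc S) (loc T) loc_map loc_map_zmod.
HB.instance Definition _ :=
  GRing.isMonoidMorphism.Build (loc S) (loc T) loc_map loc_map_monoid.

End LocMap.

Section PowersAndPrimes.
Variable A : comPzRingType.

Definition powers_set (f : A) : set A := [set s | exists n, s = f ^+ n].

Lemma powers_set1 f : powers_set f 1.
Proof. by exists 0%N. Qed.

Lemma powers_setM f s t :
  powers_set f s -> powers_set f t -> powers_set f (s * t).
Proof. by move=> [n ->] [k ->]; exists (n + k)%N; rewrite exprD. Qed.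

Definition powers (f : A) := MulSet (powers_set1 f) (@powers_setM f).

Lemma powers_self (f : A) : mul_set (powers f) f.
Proof. by exists 1%N. Qed.

Lemma prime_compl1 (p : Spec A) : (~` point_ideal p) 1.
Proof. by have [] := point_prime p. Qed.

Lemma prime_complM (p : Spec A) s t :
  (~` point_ideal p) s -> (~` point_ideal p) t -> (~` point_ideal p) (s * t).
Proof. by move=> hs ht; have [_ _ pM] := point_prime p => /pM[]. Qed.

Definition prime_compl (p : Spec A) :=
  MulSet (@prime_compl1 p) (@prime_complM p).

End PowersAndPrimes.

Definition stalk (A : comPzRingType) (p : Spec A) := loc (prime_compl p).

(* The structure sheaf of Spec A: functions on U with values in the stalks
   which locally are fractions. Only the values at open U are meaningful. *)
Section StructureSheaf.
Variables (A : comPzRingType) (U : set (Spec A)).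

Definition locally_frac (s : forall p, U p -> stalk p) : Prop :=
  forall p, U p -> exists (V : set (Spec A)) (a f : A), [/\ open V, V p &
    forall q (Uq : U q), V q ->
      exists nf : mul_set (prime_compl q) f, s q Uq = mkfrac a nf].

Record section := Section_ {
  sec_val :> forall p, U p -> stalk p;
  sec_frac : locally_frac sec_val }.

HB.instance Definition _ := gen_eqMixin section.
HB.instance Definition _ := gen_choiceMixin section.

Lemma section_eq (s t : section) : (forall p Up, s p Up = t p Up) -> s = t.
Proof.
case: s t => [s hs] [t ht] /= e.
have {}e : s = t by apply/functional_extensionality_dep => p; apply/funext.
by subst t; rewrite (Prop_irrelevance hs ht).
Qed.

Lemma locally_frac_const (c : A) :
  locally_frac (fun p _ => to_loc (prime_compl p) c).
Proof.
move=> p Up; exists setT, c, 1; split=> //; first exact: openT.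
by move=> q Uq _; exists (mul_set1 _).
Qed.

Lemma locally_fracN (s : section) : locally_frac (fun p Up => - s p Up).
Proof.
move=> p Up; have [V [a [f [oV Vp h]]]] := sec_frac s Up.
exists V, (- a), f; split=> // q Uq Vq; have [nf e] := h q Uq Vq.
by exists nf; rewrite e locN.
Qed.

Lemma locally_fracD (s t : section) :
  locally_frac (fun p Up => s p Up + t p Up).
Proof.
move=> p Up; have [V [a [f [oV Vp h]]]] := sec_frac s Up.
have [W [b [g [oW Wp k]]]] := sec_frac t Up.
exists (V `&` W), (a * g + b * f), (f * g); split=> //; first exact: openI.
move=> q Uq [Vq Wq]; have [nf e] := h q Uq Vq; have [ng e'] := k q Uq Wq.
by exists (mul_setM nf ng); rewrite e e' locD.
Qed.

Lemma locally_fracM (s t : section) :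
  locally_frac (fun p Up => s p Up * t p Up).
Proof.
move=> p Up; have [V [a [f [oV Vp h]]]] := sec_frac s Up.
have [W [b [g [oW Wp k]]]] := sec_frac t Up.
exists (V `&` W), (a * b), (f * g); split=> //; first exact: openI.
move=> q Uq [Vq Wq]; have [nf e] := h q Uq Vq; have [ng e'] := k q Uq Wq.
by exists (mul_setM nf ng); rewrite e e' locM.
Qed.

Definition sec_const (c : A) := Section_ (locally_frac_const c).
Definition sec_opp (s : section) := Section_ (locally_fracN s).
Definition sec_add (s t : section) := Section_ (locally_fracD s t).
Definition sec_mul (s t : section) := Section_ (locally_fracM s t).

Lemma sec_addA : associative sec_add.
Proof. by move=> s t u; apply: section_eq => p Up; apply: addrA. Qed.
Lemma sec_addC : commutative sec_add.
Proof. by move=> s t; apply: section_eq => p Up; apply: addrC. Qed.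
Lemma sec_add0 : left_id (sec_const 0) sec_add.
Proof. by move=> s; apply: section_eq => p Up; apply: add0r. Qed.
Lemma sec_addN : left_inverse (sec_const 0) sec_opp sec_add.
Proof. by move=> s; apply: section_eq => p Up; apply: addNr. Qed.
Lemma sec_mulA : associative sec_mul.
Proof. by move=> s t u; apply: section_eq => p Up; apply: mulrA. Qed.
Lemma sec_mulC : commutative sec_mul.
Proof. by move=> s t; apply: section_eq => p Up; apply: mulrC. Qed.
Lemma sec_mul1 : left_id (sec_const 1) sec_mul.
Proof. by move=> s; apply: section_eq => p Up; apply: mul1r. Qed.
Lemma sec_mulD : left_distributive sec_mul sec_add.
Proof. by move=> s t u; apply: section_eq => p Up; apply: mulrDl. Qed.

HB.instance Definition _ :=
  GRing.isZmodule.Build section sec_addA sec_addC sec_add0 sec_addN.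
HB.instance Definition _ := GRing.Zmodule_isComPzRing.Build section
  sec_mulA sec_mulC sec_mul1 sec_mulD.

End StructureSheaf.

Section Restriction.
Variables (A : comPzRingType) (U V : set (Spec A)) (VU : V `<=` U).

Lemma locally_frac_res (s : section U) :
  locally_frac (fun p (Vp : V p) => s p (VU Vp)).
Proof.
move=> p Vp; have [W [a [f [oW Wp h]]]] := sec_frac s (VU Vp).
by exists W, a, f; split=> // q Vq; apply: h.
Qed.

Definition sec_res (s : section U) : section V :=
  Section_ (locally_frac_res s).

Lemma sec_res_zmod : zmod_morphism sec_res.
Proof. by move=> s t; apply: section_eq. Qed.

Lemma sec_res_monoid : monoid_morphism sec_res.
Proof. by split=> [|s t]; apply: section_eq. Qed.

HB.instance Definition _ :=
  GRing.isZmodMorphism.Build (section U) (section V) sec_res sec_res_zmod.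
HB.instance Definition _ :=
  GRing.isMonoidMorphism.Build (section U) (section V) sec_res sec_res_monoid.

End Restriction.

(* A space with a presheaf of rings; the sheaf axioms, which hold for spectra
   and their open subschemes, play no role in the notion of isomorphism, and
   neither do the values of [sheaf] at non-open sets. *)
Record ringedSpace := RingedSpace {
  space :> topologicalType;
  sheaf : set space -> comPzRingType;
  restr : forall V W : set space, W `<=` V -> {rmorphism sheaf V -> sheaf W} }.

Definition spec_scheme (A : comPzRingType) : ringedSpace :=
  @RingedSpace (Spec A) (fun U => section U)
    (fun V W WV => sec_res WV : {rmorphism section V -> section W}).

Definition open_subscheme (X : ringedSpace) (U : set X) : ringedSpace :=
  @RingedSpace (U : Type) (fun V => sheaf (set_val @` V))
    (fun V W WV => restr (image_subset set_val WV)).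
Arguments open_subscheme X U : clear implicits.

(* An isomorphism of ringed spaces between locally ringed spaces is
   automatically one of locally ringed spaces. *)
Definition ringed_iso (X Y : ringedSpace) : Prop :=
  exists (f : X -> Y) (g : Y -> X)
    (phi : forall V : set Y, open V ->
       {rmorphism sheaf V -> sheaf (f @^-1` V)}),
  [/\ cancel f g /\ cancel g f,
      continuous f /\ continuous g,
      forall V (oV : open V), bijective (phi V oV) &
      forall V W (oV : open V) (oW : open W) (WV : W `<=` V) (s : sheaf V),
        restr (preimage_subset WV) (phi V oV s) = phi W oW (restr WV s)].

Definition affine (X : ringedSpace) : Prop :=
  exists B : comPzRingType, ringed_iso X (spec_scheme B).

(* The top Cech cohomology H^d(y_1, ..., y_d; A), i.e. the cokernel of
   \bigoplus_k A_(y_1 .. y_(k-1) y_(k+1) .. y_d) -> A_(y_1 .. y_d). *)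
Section Cech.
Variables (A : comPzRingType) (d : nat) (y : 'I_d -> A).

Definition cech_top := loc (powers (\prod_i y i)).
Definition cech_face (k : 'I_d) := loc (powers (\prod_(i | i != k) y i)).

Lemma cech_face_inverts k : inverts (idfun : {rmorphism A -> A})
  (powers (\prod_(i | i != k) y i)) (powers (\prod_i y i)).
Proof.
move=> _ [n ->]; exists (y k ^+ n); exists n.
by rewrite /= -exprMn [in RHS](bigD1 k) //= mulrC.
Qed.

Definition cech_diff (b : forall k, cech_face k) : cech_top :=
  \sum_(k < d) (-1) ^+ k * loc_map (@cech_face_inverts k) (b k).

Definition cech_cobd : {pred cech_top} :=
  [pred z | `[< exists b, z = cech_diff b >]].

Lemma cech_cobd_zmod : zmod_closed cech_cobd.
Proof.
split; first apply/asboolP.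
  exists (fun=> 0); apply/esym/big1 => k _.
  by rewrite raddf0 mulr0.
move=> _ _ /asboolP[b ->] /asboolP[c ->]; apply/asboolP.
exists (fun k => b k - c k); rewrite /cech_diff -sumrB.
by apply: eq_bigr => k _; rewrite raddfB mulrBr.
Qed.

HB.instance Definition _ :=
  GRing.isZmodClosed.Build cech_top cech_cobd cech_cobd_zmod.

Definition cech_H : zmodType := Quotient.quot cech_cobd.

Definition cech_class (z : cech_top) : cech_H := \pi_cech_H z.

(* The class 1/(y_1 .. y_d). *)
Definition paraclass : cech_H :=
  cech_class (mkfrac 1 (powers_self (\prod_i y i))).

End Cech.

Section CechMap.
Variables (A B : comPzRingType) (phi : {rmorphism A -> B}).
Variables (d : nat) (y : 'I_d -> A).

Lemma cech_top_inverts :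
  inverts phi (powers (\prod_i y i)) (powers (\prod_i phi (y i))).
Proof.
by move=> _ [n ->]; exists 1; exists n; rewrite mulr1 rmorphXn rmorph_prod.
Qed.

Definition cech_map (c : cech_H y) : cech_H (phi \o y) :=
  cech_class (loc_map cech_top_inverts (repr c) : cech_top (phi \o y)).

Lemma cech_face_inverts_map k : inverts phi
  (powers (\prod_(i | i != k) y i)) (powers (\prod_(i | i != k) phi (y i))).
Proof.
by move=> _ [n ->]; exists 1; exists n; rewrite mulr1 rmorphXn rmorph_prod.
Qed.

Lemma loc_map_diff (b : forall k, cech_face y k) :
  loc_map cech_top_inverts (cech_diff b) =
  cech_diff (fun k => loc_map (cech_face_inverts_map (k:=k)) (b k)
                      : cech_face (phi \o y) k).
Proof.
pose psi : {rmorphism loc _ -> loc _} := loc_map cech_top_inverts.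
rewrite /cech_diff -[LHS]/(psi _) rmorph_sum; apply: eq_bigr => k _.
rewrite rmorphM rmorphXn rmorphN rmorph1 /psi /=; congr (_ * _).
have [a [s [Ss ->]]] := frac_surj (b k).
have [c Tc] := cech_face_inverts Ss.
have [e Te] := cech_face_inverts_map Ss.
have [g Tg] := cech_face_inverts (y := phi \o y) Te.
have [h Th] := cech_top_inverts Tc.
rewrite (loc_mapE _ _ _ Tc) (loc_mapE _ _ _ Te).
rewrite (loc_mapE _ _ _ Th) (loc_mapE _ _ _ Tg).
by apply: frac_congr; rewrite /= !rmorphM; ring.
Qed.

Lemma cech_mapE (z : cech_top y) :
  cech_map (cech_class z) =
  cech_class (loc_map cech_top_inverts z : cech_top (phi \o y)).
Proof.
apply/eqmodP; rewrite /= /Quotient.equiv -raddfB.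
have /eqmodP/asboolP [b ->] := reprK (cech_class z).
by apply/asboolP; eexists; exact: loc_map_diff.
Qed.

Lemma cech_map_paraclass : cech_map (paraclass y) = paraclass (phi \o y).
Proof.
rewrite cech_mapE; congr cech_class.
have T : mul_set (powers (\prod_i phi (y i))) (phi (\prod_i y i) * 1).
  by rewrite mulr1 rmorph_prod; apply: powers_self.
rewrite (loc_mapE _ _ _ T); apply: frac_congr.
by rewrite rmorph1 rmorph_prod /=; ring.
Qed.

End CechMap.

Section Parasolid.
Variables (R : comPzRingType) (m : set R) (A : comPzRingType).
Variable phi : {rmorphism R -> A}.

Definition parameters (d : nat) (x : 'I_d -> R) : Prop :=
  zeros (range x) = zeros m.

Definition parasolid (d : nat) : Prop :=
  forall x : 'I_d -> R, parameters x ->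
    paraclass x != 0 -> cech_map phi (paraclass x) != 0.

(* H^d_m(A) is the top Cech cohomology of A at a system of parameters of R
   (localizing the R-module A at x is localizing the ring A at phi x). Up to
   canonical isomorphism it does not depend on the system, so it is nonzero iff
   it is so at some system. *)
Definition top_lc_nonzero (d : nat) : Prop :=
  exists x : 'I_d -> R, parameters x /\
    exists c : cech_H (phi \o x), c != 0.

Definition ext_ideal : set A := ideal_gen (phi @` m).

End Parasolid.

(* Main.v *)
(* In dimension 1 everything says that x^k = a x^(k+1) for some k and a: then
   D(x) = V(1 - a x), and conversely, if D(x) is closed, then 1 = i + r x where
   x i is nilpotent.

   In dimension 2 everything is governed by the monomial relation
   (x y)^k = a x^(k+1) + b y^(k+1) in A, for some (equivalently any) parameters
   x, y: it says that the paraclass 1/(x y) vanishes, it forces all 1/(x y)^N,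
   hence H^2, to vanish, and it says that x and y generate the unit ideal of the
   ring B of functions on U = D(x, y). The latter holds if U is affine; it
   implies U = Spec B because some power of x, or of y, times any b in B comes
   from A.

   It remains to find parameters of R without monomial relation. Take primes
   P0 < P < m with x in P \ P0 and y in m \ P. The contractions to R of the
   powers of x R_P give a strict chain of N^2 ideals above (x^N, y^N), whereas a
   monomial relation removes a fixed proportion of the monomials x^i y^j and so
   bounds the length of R/(x^N, y^N) by O(N^(2 - epsilon)) along the powers N of
   some integer. *)

From HB Require Import structures.
Require Import Defs.
From mathcomp Require Import all_boot all_order all_algebra ring zify.
From mathcomp Require Import ring_quotient generic_quotient.
From mathcomp Require Import all_classical topology.

Set Implicit Arguments.
Unset Strict Implicit.
Unset Printing Implicit Defensive.

Import GRing.Theory.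

Local Open Scope classical_set_scope.
Local Open Scope ring_scope.

(** * Zorn's lemma, ideals and prime ideals *)

Lemma Zorn_nonempty_chains (T : Type) (C : set (set T)) (I0 : set T) :
  C I0 ->
  (forall F, F `<=` C -> total_on F subset -> F !=set0 ->
     C (\bigcup_(X in F) X)) ->
  exists M, C M /\ forall J, C J -> M `<=` J -> J = M.
Proof.
(* The empty set is added to the family to serve as the union of the empty chain. Should it be the
   maximal element found, then it equals [I0], which contains it. *)
move=> C0 hC; have [|M [CM maxM]] := @Zorn_bigcup T (C `|` [set set0]).
  move=> F FC Ftot; pose G := F `&` C.
  have -> : \bigcup_(X in F) X = \bigcup_(X in G) X.
    apply/seteqP; split=> t [X FX Xt]; last by exists X => //; case: FX.
    exists X => //; split=> //; have [//|X0] := FC _ FX.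
    by rewrite X0 in Xt.
  have [G0|/set0P Gn0] := eqVneq G set0.
    by right; rewrite G0 /= bigcup_set0.
  left; apply: hC => // [X [_ //]|X Y [FX _] [FY _]]; exact: Ftot.
have maxM' J : C J -> M `<=` J -> J = M.
  move=> CJ MJ; apply: contrapT => nJM; apply: (maxM J); last by left.
  by split=> // JM; apply: nJM; apply/seteqP.
case: CM => [CM|M0]; first by exists M.
exists M; split=> //; rewrite -(maxM' _ C0) //.
by rewrite M0; exact: sub0set.
Qed.

Section IdealTheory.
Variable A : comPzRingType.
Implicit Types (I J P : set A).

Definition adjoin I (a : A) : set A := [set z | exists i r, I i /\ z = i + r * a].

Definition colon I (a : A) : set A := [set t | I (t * a)].

Lemma ideal0 I : is_ideal I -> I 0.
Proof. by case. Qed.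

Lemma idealD I a b : is_ideal I -> I a -> I b -> I (a + b).
Proof. by case=> _ + _; apply. Qed.

Lemma idealMl I a b : is_ideal I -> I b -> I (a * b).
Proof. by case=> _ _; apply. Qed.

Lemma idealMr I a b : is_ideal I -> I a -> I (a * b).
Proof. by move=> hI Ia; rewrite mulrC; apply: idealMl. Qed.

Lemma idealN I a : is_ideal I -> I a -> I (- a).
Proof. by move=> hI Ia; rewrite -mulN1r; apply: idealMl. Qed.

Lemma idealB I a b : is_ideal I -> I a -> I b -> I (a - b).
Proof. by move=> hI Ia Ib; apply: idealD => //; apply: idealN. Qed.

Lemma ideal_cancelr I a b : is_ideal I -> I b -> I (a + b) -> I a.
Proof. by move=> hI Ib /idealB - /(_ _ hI Ib); rewrite addrK. Qed.

Lemma ideal_cancell I a b : is_ideal I -> I a -> I (a + b) -> I b.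
Proof. by move=> hI Ia; rewrite addrC; apply: ideal_cancelr. Qed.

Lemma ideal_sum (T : Type) (s : seq T) (Q : pred T) (F : T -> A) I :
  is_ideal I -> (forall i, I (F i)) -> I (\sum_(i <- s | Q i) F i).
Proof.
by move=> hI hF; elim/big_rec: _ => [|i x _]; [apply: ideal0|apply: idealD].
Qed.

Lemma ideal_gen_ideal E : is_ideal (@ideal_gen A E).
Proof.
split=> [I hI _|a b ha hb I hI EI|a b hb I hI EI].
- exact: ideal0.
- by apply: idealD => //; [apply: ha|apply: hb].
- by apply: idealMl => //; apply: hb.
Qed.

Lemma sub_ideal_gen E : E `<=` @ideal_gen A E.
Proof. by move=> e Ee I _; apply. Qed.

Lemma adjoin_ideal I a : is_ideal I -> is_ideal (adjoin I a).
Proof.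
move=> hI; split=> [|_ _ [i [r [Ii ->]]] [j [s [Ij ->]]]|c _ [i [r [Ii ->]]]].
- by exists 0, 0; split; [apply: ideal0|ring].
- by exists (i + j), (r + s); split; [apply: idealD|ring].
- by exists (c * i), (c * r); split; [apply: idealMl|ring].
Qed.

Lemma sub_adjoin I a : I `<=` adjoin I a.
Proof. by move=> i Ii; exists i, 0; split=> //; ring. Qed.

Lemma adjoin_self I a : is_ideal I -> adjoin I a a.
Proof. by move=> hI; exists 0, 1; split; [apply: ideal0|ring]. Qed.

Lemma adjoin_sub I J a : is_ideal J -> I `<=` J -> J a -> adjoin I a `<=` J.
Proof.
by move=> hJ IJ Ja _ [i [r [/IJ Ji ->]]]; apply: idealD => //; apply: idealMl.
Qed.

Lemma adjoinS I J a : I `<=` J -> adjoin I a `<=` adjoin J a.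
Proof. by move=> IJ _ [i [r [/IJ Ji ->]]]; exists i, r. Qed.

Lemma colon_ideal I a : is_ideal I -> is_ideal (colon I a).
Proof.
move=> hI; split=> [|b c|b c]; rewrite /colon /=.
- by rewrite mul0r; apply: ideal0.
- by rewrite mulrDl; apply: idealD.
- by rewrite -mulrA; apply: idealMl.
Qed.

Lemma chain_bigcup_ideal (F : set (set A)) :
  (forall X, F X -> is_ideal X) -> total_on F subset -> F !=set0 ->
  is_ideal (\bigcup_(X in F) X).
Proof.
move=> hF Ftot [X0 FX0]; split.
- by exists X0 => //; apply: ideal0; apply: hF.
- move=> a b [X FX Xa] [Y FY Yb]; have [XY|YX] := Ftot _ _ FX FY.
    by exists Y => //; apply: idealD; [exact: hF|exact: XY|].
  by exists X => //; apply: idealD; [exact: hF| |exact: YX].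
- by move=> a b [X FX Xb]; exists X => //; apply: idealMl => //; apply: hF.
Qed.

Lemma exists_maximal_avoiding I (f : A) :
  is_ideal I -> (forall n, ~ I (f ^+ n)) ->
  exists M, [/\ is_ideal M, I `<=` M, forall n, ~ M (f ^+ n) &
    forall J, is_ideal J -> M `<=` J -> (forall n, ~ J (f ^+ n)) -> J = M].
Proof.
move=> hI fI; pose C := [set J | [/\ is_ideal J, I `<=` J &
  forall n, ~ J (f ^+ n)]].
have [|F FC Ftot F0|M [[hM IM fM] maxM]] := @Zorn_nonempty_chains A C I.
- by split.
- split; first by apply: chain_bigcup_ideal => // X /FC[].
    by case: F0 => X FX i Ii; exists X => //; have [_ /(_ i Ii)] := FC _ FX.
  by move=> n [X /FC[_ _ /(_ n)]].
exists M; split=> // J hJ MJ fJ; apply: maxM => //; split=> //.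
exact: subset_trans MJ.
Qed.

(** An ideal [M] maximal among those free of powers of [f] is prime: if [a] and [b] are outside [M],
    then [M + (a)] and [M + (b)] contain powers of [f], whose product lies in [M + (ab)]. With
    [f = 1] this yields a prime above any proper ideal. *)
Lemma exists_prime_avoiding I (f : A) :
  is_ideal I -> (forall n, ~ I (f ^+ n)) ->
  exists p : Spec A, I `<=` p /\ ~ point_ideal p f.
Proof.
move=> hI fI; have [M [hM IM fM maxM]] := exists_maximal_avoiding hI fI.
have adjM a : ~ M a -> exists n, adjoin M a (f ^+ n).
  move=> nMa; apply: contrapT => /forallNP h; apply: nMa.
  have <- : adjoin M a = M.
    by apply: maxM => //; [apply: adjoin_ideal|apply: sub_adjoin].
  exact: adjoin_self.
suff pM : prime_ideal M by exists (SpecPoint pM); split=> //; exact: (fM 1%N).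
split=> // [M1|a b Mab]; first exact: (fM 0%N).
apply: contrapT => /not_orP[/adjM[n [i [r [Mi en]]]] /adjM[k [j [s [Mj ek]]]]].
apply: (fM (n + k)%N); rewrite exprD en ek.
have -> : (i + r * a) * (j + s * b) =
  i * (j + s * b) + (r * a) * j + r * s * (a * b) by ring.
by do 2?apply: idealD => //; [exact: idealMr|exact: idealMl|exact: idealMl].
Qed.

Lemma exists_maximal_ideal I :
  is_ideal I -> ~ I 1 -> exists2 M, maximal_ideal M & I `<=` M.
Proof.
move=> hI I1; have [|M [hM IM M1 maxM]] := @exists_maximal_avoiding I 1 hI.
  by move=> n; rewrite expr1n.
have {}M1 : ~ M 1 := M1 0%N.
exists M => //; split=> // J hJ MJ; have [J1|J1] := pselect (J 1); first by right.
by left; apply: maxM => // n; rewrite expr1n.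
Qed.

Lemma primeM (p : Spec A) a b : point_ideal p (a * b) ->
  point_ideal p a \/ point_ideal p b.
Proof. by have [_ _ /(_ a b)] := point_prime p. Qed.

Lemma prime1 (p : Spec A) : ~ point_ideal p 1.
Proof. by have [] := point_prime p. Qed.

Lemma primeI (p : Spec A) : is_ideal (point_ideal p).
Proof. by have [] := point_prime p. Qed.

Lemma primeNM (p : Spec A) a b :
  ~ point_ideal p a -> ~ point_ideal p b -> ~ point_ideal p (a * b).
Proof. by move=> pa pb /primeM[]. Qed.

Lemma primeX (p : Spec A) a n : point_ideal p (a ^+ n) -> point_ideal p a.
Proof.
elim: n => [/prime1//|n IH]; rewrite exprS => /primeM[//|]; exact: IH.
Qed.

Lemma primeNX (p : Spec A) a n : ~ point_ideal p a -> ~ point_ideal p (a ^+ n).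
Proof. by move=> pa /primeX. Qed.

Lemma spec_eq (p q : Spec A) : point_ideal p = point_ideal q -> p = q.
Proof.
case: p q => [P hP] [Q hQ] /= e; subst Q.
by rewrite (Prop_irrelevance hP hQ).
Qed.

End IdealTheory.

Lemma comap_prime (A B : comPzRingType) (phi : {rmorphism A -> B}) (q : Spec B) :
  prime_ideal [set a | point_ideal q (phi a)].
Proof.
split; first split=> [|a b qa qb|a b qb]; rewrite /= ?rmorph0 ?rmorphD ?rmorphM.
- by apply: ideal0; exact: primeI.
- by apply: idealD => //; exact: primeI.
- by apply: idealMl => //; exact: primeI.
- by rewrite rmorph1; exact: prime1.
- by move=> a b /=; rewrite rmorphM => /primeM.
Qed.

Definition comap (A B : comPzRingType) (phi : {rmorphism A -> B}) (q : Spec B) :=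
  SpecPoint (comap_prime phi q).

Lemma zero_ideal (A : comPzRingType) : is_ideal [set 0 : A].
Proof. by split=> [//|a b -> ->|a b ->]; rewrite /= ?addr0 ?mulr0. Qed.

(** * Noetherian rings *)

Section Noetherian.
Variable R : comPzRingType.
Hypothesis hR : noetherian R.
Implicit Types (I J P : set R).

(** The union of a nonempty chain is finitely generated, and its generators already lie in one
    member; so the union is that member and Zorn's lemma applies. *)
Lemma noetherian_max (C : set (set R)) I0 :
  (forall I, C I -> is_ideal I) -> C I0 ->
  exists2 M, C M & forall J, C J -> M `<=` J -> J = M.
Proof.
move=> hC C0; have [//|F FC Ftot F0|M [CM maxM]] := @Zorn_nonempty_chains R C I0;
  last by exists M.
have hU : is_ideal (\bigcup_(X in F) X).
  by apply: chain_bigcup_ideal => // X /FC/hC.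
have [s es] := hR hU.
have [X FX sX] : exists2 X, F X & [set` s] `<=` X.
  have : [set` s] `<=` \bigcup_(X in F) X by rewrite es; exact: sub_ideal_gen.
  elim: s {es} => [_|a s IH sF]; first by case: F0 => X FX; exists X.
  have [b sb|X FX sX] := IH.
    by apply: sF; rewrite /= inE [b \in s]sb orbT.
  have [Y FY Ya] : (\bigcup_(X in F) X) a by apply: sF; rewrite /= mem_head.
  have [XY|YX] := Ftot _ _ FX FY.
    exists Y => // b /=; rewrite inE => /orP[/eqP->//|/sX]; exact: XY.
  by exists X => // b /=; rewrite inE => /orP[/eqP->|/sX//]; exact: YX.
suff -> : \bigcup_(X in F) X = X by apply: FC.
apply/seteqP; split; last exact: bigcup_sup.
by rewrite es => a /(_ X (hC _ (FC _ FX)) sX).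
Qed.

Lemma noetherian_ind (Q : set R -> Prop) :
  (forall I, is_ideal I ->
     (forall J, is_ideal J -> I `<=` J -> ~ J `<=` I -> Q J) -> Q I) ->
  forall I, is_ideal I -> Q I.
Proof.
move=> step I hI; apply: contrapT => nQ.
have [|//|M [hM nQM] maxM] :=
  @noetherian_max [set J | is_ideal J /\ ~ Q J] I; first by move=> J [].
apply: nQM; apply: step => // J hJ MJ nJM; apply: contrapT => nQJ.
by apply: nJM; rewrite (maxM J).
Qed.

End Noetherian.

(** * Length of ideals in a local ring *)

(* The steps of a [weak_series] may be trivial, so it bounds the length of R/I
   from above; a [strict_chain] bounds it from below. *)
Fixpoint weak_series (R : comPzRingType) (m : set R) n (I : set R) : Prop :=
  if n is n'.+1 then
    exists a, (forall r, m r -> I (r * a)) /\ weak_series m n' (adjoin I a)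
  else I 1.

Fixpoint strict_chain (R : comPzRingType) k (I : set R) : Prop :=
  if k is k'.+1 then
    exists K, [/\ is_ideal K, I `<` K & strict_chain k' K]
  else True.

Definition ideal2 (R : comPzRingType) (a b : R) : set R :=
  [set z | exists r s, z = r * a + s * b].

Lemma ideal2_ideal (R : comPzRingType) (a b : R) : is_ideal (ideal2 a b).
Proof.
split=> [|_ _ [r [s ->]] [r' [s' ->]]|c _ [r [s ->]]].
- by exists 0, 0; ring.
- by exists (r + r'), (s + s'); ring.
- by exists (c * r), (c * s); ring.
Qed.

Lemma ideal2_sub (R : comPzRingType) (a b : R) (I : set R) :
  is_ideal I -> I a -> I b -> ideal2 a b `<=` I.
Proof. by move=> hI Ia Ib _ [r [s ->]]; apply: idealD => //; apply: idealMl. Qed.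

Lemma ideal2_l (R : comPzRingType) (a b : R) : ideal2 a b a.
Proof. by exists 1, 0; ring. Qed.

Lemma ideal2_r (R : comPzRingType) (a b : R) : ideal2 a b b.
Proof. by exists 0, 1; ring. Qed.

Lemma weak_series_sub (R : comPzRingType) (m : set R) n (I J : set R) :
  I `<=` J -> weak_series m n I -> weak_series m n J.
Proof.
elim: n I J => [|n IH] I J IJ /=; first exact: IJ.
move=> [a [ma hn]]; exists a; split; first by move=> r /ma/IJ.
apply: IH hn; exact: adjoinS.
Qed.

Lemma strict_chain_sub (R : comPzRingType) k (I J : set R) :
  I `<=` J -> strict_chain k J -> strict_chain k I.
Proof.
case: k => [//|k] IJ /= [K [hK JK hk]]; exists K; split=> //.
by have [JK' nKJ] := JK; split; [exact: subset_trans JK'|move=> /subset_trans/(_ IJ)].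
Qed.

(* Multiplication by [g] carries a series of R/I onto one of (E + gR)/E. *)
Lemma weak_series_scale (R : comPzRingType) (m : set R) n p (I E : set R) g :
  is_ideal E -> weak_series m n I -> (forall i, I i -> E (i * g)) ->
  weak_series m p (adjoin E g) -> weak_series m (n + p) E.
Proof.
move=> + + + hp; elim: n I E hp => [|n IH] I E hp hE /=.
  move=> I1 IE; apply: weak_series_sub hp; apply: adjoin_sub => //.
  by rewrite -[g]mul1r; apply: IE.
move=> [a [ma hn]] IE; exists (a * g); split.
  by move=> r mr; rewrite mulrA; apply/IE/ma.
apply: (IH (adjoin I a)) => //; first 2 last.
- move=> _ [i [r [Ii ->]]]; exists (i * g), r; split; first exact: IE.
  by ring.
- by apply: weak_series_sub hp; apply: adjoinS; apply: sub_adjoin.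
- exact: adjoin_ideal.
Qed.

Section LocalRing.
Variables (R : comPzRingType) (m : set R).
Hypothesis hm : local_ring_with m.
Implicit Types (I J K Q : set R).

Lemma local_ideal : is_ideal m.
Proof. by have [[]] := hm. Qed.

Lemma local_one : ~ m 1.
Proof. by have [[]] := hm. Qed.

Lemma local_proper I : is_ideal I -> ~ I 1 -> I `<=` m.
Proof.
by move=> hI /(exists_maximal_ideal hI) [M /(proj2 hm) <-].
Qed.

Lemma local_prime_sub (p : Spec R) : point_ideal p `<=` m.
Proof. apply: local_proper; [exact: primeI|exact: prime1]. Qed.

Lemma local_prime : prime_ideal m.
Proof.
split; [exact: local_ideal|exact: local_one|move=> a b mab].
apply: contrapT => /not_orP[ma mb]; apply: ma.
apply: (local_proper (colon_ideal b local_ideal)) => //.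
by rewrite /colon /= mul1r.
Qed.

Definition closed_point : Spec R := SpecPoint local_prime.

Lemma local_unit_cancel K r a : is_ideal K -> ~ m r -> K (r * a) -> K a.
Proof.
move=> hK mr Kra; apply: contrapT => nKa; apply: mr.
by apply: (local_proper (colon_ideal a hK)) => //; rewrite /colon /= mul1r.
Qed.

Lemma local_one_sub r : m r -> ~ m (1 - r).
Proof.
move=> mr mr1; apply: local_one; rewrite -[1](subrK r).
exact: (idealD local_ideal).
Qed.

(** As [(I + (a))/I] has length at most one, passing to [I + (a)] costs at most one step. If the
    first term [K] misses [a], it is replaced by [K + (a)]. This is still strictly above [I + (a)]:
    an element [i + r a] of [K] has [r] in [m], since a unit [r] would put [a] in [K], and hence
    lies in [I]. *)
Lemma strict_chain_adjoin k I a : is_ideal I -> (forall r, m r -> I (r * a)) ->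
  strict_chain k I -> strict_chain k.-1 (adjoin I a).
Proof.
elim: k I => [//|k IH] I hI ma /= [K [hK [IK KI] hk]].
have [Ka|nKa] := pselect (K a).
  by apply: strict_chain_sub hk; apply: adjoin_sub.
have {}IH := IH _ hK (fun r mr => IK _ (ma r mr)) hk.
case: k hk IH => [//|k] _ IH; exists (adjoin K a); split=> //.
  exact: adjoin_ideal.
split; first exact: adjoinS.
move=> sub; apply: KI => x Kx.
have [i [r [Ii ex]]] := sub _ (sub_adjoin a Kx).
have Kra : K (r * a).
  have -> : r * a = x - i by rewrite ex; ring.
  by apply: idealB => //; apply: IK.
have mr : m r.
  by apply: contrapT => nmr; apply: nKa; apply: local_unit_cancel Kra.
by rewrite ex; apply: idealD => //; apply: ma.
Qed.

Lemma strict_chain_le n k I J : is_ideal I -> is_ideal J -> I `<=` J ->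
  weak_series m n I -> strict_chain k J -> (k <= n)%N.
Proof.
elim: n k I J => [|n IH] k I J hI hJ IJ /=.
  move=> /IJ J1; case: k => [//|k] /= [K [hK [JK KJ] _]]; case: KJ => x _.
  by rewrite -[x]mulr1; apply: idealMl.
move=> [a [ma hn]] hk.
have := IH k.-1 (adjoin I a) (adjoin J a) (adjoin_ideal a hI)
  (adjoin_ideal a hJ) (adjoinS IJ) hn.
move=> /(_ (strict_chain_adjoin hJ (fun r mr => IJ _ (ma r mr)) hk)); lia.
Qed.

Section Noetherian.
Hypothesis hR : noetherian R.

(** Take [K] maximal among the ideals from [Q'] to [Q] that differ from [Q]. For [a] in [Q] outside
    [K], maximality gives [Q = K + (a)], so [a = b + y (i + r a)] and the unit [1 - y r] carries [a]
    into [K]. *)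
Lemma nakayama Q Q' y : is_ideal Q -> is_ideal Q' -> Q' `<=` Q -> m y ->
  (forall a, Q a -> exists b c, [/\ Q' b, Q c & a = b + y * c]) -> Q `<=` Q'.
Proof.
move=> hQ hQ' Q'Q my hy; apply: contrapT => nQQ'.
have [||K [hK Q'K KQ nQK] maxK] := noetherian_max hR
  (C := [set K | [/\ is_ideal K, Q' `<=` K, K `<=` Q & ~ Q `<=` K]]) (I0 := Q').
- by move=> K [].
- by split.
apply: nQK => a Qa; apply: contrapT => nKa.
have QKa : Q `<=` adjoin K a.
  apply: contrapT => nQKa; apply: nKa; rewrite -(maxK (adjoin K a)).
  - exact: adjoin_self.
  - split=> //; first exact: adjoin_ideal.
      by apply: subset_trans Q'K _; apply: sub_adjoin.
    exact: adjoin_sub.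
  - exact: sub_adjoin.
have [b [c [Q'b Qc ea]]] := hy _ Qa.
have [i [r [Ki ec]]] := QKa _ Qc.
apply: nKa; apply: (@local_unit_cancel _ (1 - y * r)) => //.
  by apply: local_one_sub; apply: idealMr => //; exact: local_ideal.
have -> : (1 - y * r) * a = b + y * i.
  by rewrite mulrBl mul1r {1}ea ec; ring.
by apply: idealD => //; [apply: Q'K|apply: idealMl].
Qed.

(** This is an associated prime of [R/I], found as a maximal element among the annihilators of
    nonzero classes. *)
Lemma exists_prime_colon I : is_ideal I -> ~ I 1 ->
  exists a, ~ I a /\ prime_ideal (colon I a).
Proof.
move=> hI I1.
have [||M [a nIa eM] maxM] := noetherian_max hR
  (C := [set K | exists2 a, ~ I a & K = colon I a]) (I0 := colon I 1).
- by move=> _ [a _ ->]; apply: colon_ideal.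
- by exists 1.
exists a; split=> //; split; first exact: colon_ideal.
  by rewrite /colon /= mul1r.
move=> b c hbc; apply: contrapT => /not_orP[nb nc]; apply: nb.
have nIca : ~ I (c * a) by [].
rewrite -eM -(maxM (colon I (c * a))); last 2 first.
- by exists (c * a).
- by rewrite eM => x xa; rewrite /colon /= mulrCA; apply: idealMl.
by rewrite /colon /= mulrA.
Qed.

(** By Noetherian induction: the associated prime of [R/I] can only be [m], so the class it
    annihilates provides the first step of the series. *)
Lemma exists_weak_series I : is_ideal I ->
  (forall p : Spec R, I `<=` point_ideal p -> point_ideal p = m) ->
  exists n, weak_series m n I.
Proof.
move: I; apply: (noetherian_ind hR) => I hI IH Im.
have [I1|nI1] := pselect (I 1); first by exists 0%N.
have [a [nIa pa]] := exists_prime_colon hI nI1.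
have ea : colon I a = m.
  apply: (Im (SpecPoint pa)) => /= i Ii; exact: idealMr.
have [||||n hn] := IH (adjoin I a).
- exact: adjoin_ideal.
- exact: sub_adjoin.
- by move=> /(_ _ (adjoin_self a hI)).
- by move=> p hp; apply: Im; apply: subset_trans hp; apply: sub_adjoin.
by exists n.+1, a; split=> // r; rewrite -ea.
Qed.

End Noetherian.
End LocalRing.

(** * Monomial relations and upper bounds for the length *)

Definition monomial_relation (A : comPzRingType) (f g : A) : Prop :=
  exists k a b, (f * g) ^+ k = a * f ^+ k.+1 + b * g ^+ k.+1.

Lemma ideal2_Xl (A : comPzRingType) (f h z : A) T e :
  (T <= e)%N -> ideal2 (f ^+ T) h (z * f ^+ e).
Proof.
by move=> /subnK <-; exists (z * f ^+ (e - T)), 0; rewrite exprD; ring.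
Qed.

Lemma ideal2_Xr (A : comPzRingType) (f h z : A) T e :
  (T <= e)%N -> ideal2 h (f ^+ T) (z * f ^+ e).
Proof.
by move=> /subnK <-; exists 0, (z * f ^+ (e - T)); rewrite exprD; ring.
Qed.

(* With [a' := f^k - b g] and [b' := g^k - a f] one has [g^k a' = a f^(k+1)] and
   [f^k b' = b g^(k+1)]; this trades powers of one factor for powers of the
   other in the binomial expansion of [(fg)^((k+1) 2N)]. *)
Lemma monomial_relation_uniform (A : comPzRingType) (f g : A) :
  monomial_relation f g -> exists2 c, (0 < c)%N & forall N,
    ideal2 (f ^+ (c * N + N)) (g ^+ (c * N + N)) ((f * g) ^+ (c * N)).
Proof.
move=> [k [a [b e]]]; exists (2 * k.+1)%N => [//|N].
have eb : b * g ^+ k.+1 = f ^+ k * (g ^+ k - a * f).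
  by rewrite mulrBr -exprMn e !exprS; ring.
have ea : a * f ^+ k.+1 = g ^+ k * (f ^+ k - b * g).
  by rewrite mulrBr -exprMn [g * f]mulrC e !exprS; ring.
set b' := g ^+ k - a * f in eb; set a' := f ^+ k - b * g in ea.
set T := (2 * k.+1 * N + N)%N.
have -> : (f * g) ^+ (2 * k.+1 * N) =
    (f * g * (b * g ^+ k.+1) + f * g * (a * f ^+ k.+1)) ^+ (2 * N).
  rewrite -mulrDr [b * _ + _]addrC -e -exprS -exprM; congr (_ ^+ _); lia.
rewrite exprDn; have hI := ideal2_ideal (f ^+ T) (g ^+ T).
apply: ideal_sum => // i; rewrite -mulr_natl; apply: idealMl => //.
(* After the trade, the exponent of [f] in the [i]-th term is [2 (k+1) N + i], and in the other case
   that of [g] is [2 (k+1) N + (2N - i)]; one of [i] and [2N - i] is at least [N]. *)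
have [hi|hi] := leqP N i.
  have -> : (f * g * (b * g ^+ k.+1)) ^+ (2 * N - i) *
      (f * g * (a * f ^+ k.+1)) ^+ i =
      ((g * b') ^+ (2 * N - i) * (g * a) ^+ i) *
        f ^+ (k.+1 * (2 * N - i) + k.+2 * i).
    rewrite eb exprD !exprM.
    have -> : f * g * (f ^+ k * b') = f ^+ k.+1 * (g * b') by rewrite !exprS; ring.
    have -> : f * g * (a * f ^+ k.+1) = f ^+ k.+2 * (g * a).
      by rewrite !exprS; ring.
    by rewrite [(f ^+ k.+1 * _) ^+ _]exprMn [(f ^+ k.+2 * _) ^+ _]exprMn; ring.
  by apply: ideal2_Xl; rewrite /T; case: i hi => i /=; nia.
have -> : (f * g * (b * g ^+ k.+1)) ^+ (2 * N - i) *
    (f * g * (a * f ^+ k.+1)) ^+ i =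
    ((f * b) ^+ (2 * N - i) * (f * a') ^+ i) *
      g ^+ (k.+2 * (2 * N - i) + k.+1 * i).
  rewrite ea exprD !exprM.
  have -> : f * g * (g ^+ k * a') = g ^+ k.+1 * (f * a') by rewrite !exprS; ring.
  have -> : f * g * (b * g ^+ k.+1) = g ^+ k.+2 * (f * b).
    by rewrite !exprS; ring.
  by rewrite [(g ^+ k.+1 * _) ^+ _]exprMn [(g ^+ k.+2 * _) ^+ _]exprMn; ring.
by apply: ideal2_Xr; rewrite /T; case: i hi => i /=; nia.
Qed.

(** Filter by the [(c+1)^2] monomials [u^i v^j] with [i, j <= c]. Each subquotient is a quotient of
    [R/(u, v)], hence of length at most [w], and the monomial [(uv)^c] contributes nothing, which
    leaves [(c+1)^2 - 1 = c (c+2)] of them. *)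
Lemma weak_series_square (R : comPzRingType) (m : set R) (u v : R) w c :
  weak_series m w (ideal2 u v) ->
  ideal2 (u ^+ c.+1) (v ^+ c.+1) ((u * v) ^+ c) ->
  weak_series m (c * c.+2 * w) (ideal2 (u ^+ c.+1) (v ^+ c.+1)).
Proof.
move=> hw huv; set D := c.+1 in huv *.
(* [E i 0] is [(u^i, v^D)] and [E i D] is [(u^(i+1), v^D)], so a full row leads from one pure power
   of [u] to the next. *)
pose E i j := adjoin (ideal2 (u ^+ i.+1) (v ^+ D)) (u ^+ i * v ^+ j).
have E_ideal i j : is_ideal (E i j) by apply/adjoin_ideal/ideal2_ideal.
have El i j : E i j (u ^+ i.+1) by apply: sub_adjoin; apply: ideal2_l.
have Er i j : E i j (v ^+ D) by apply: sub_adjoin; apply: ideal2_r.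
have Em i j : E i j (u ^+ i * v ^+ j) by apply/adjoin_self/ideal2_ideal.
have row i p : weak_series m p (ideal2 (u ^+ i) (v ^+ D)) ->
    forall j, weak_series m (j * w + p) (E i j).
  move=> hp; elim=> [|j IH].
    apply: weak_series_sub hp; apply: ideal2_sub => //.
    by have := Em i 0%N; rewrite mulr1.
  rewrite mulSn -addnA.
  apply: (weak_series_scale (I := ideal2 u v) (g := u ^+ i * v ^+ j)) => //.
    move=> _ [r [s ->]].
    have -> : (r * u + s * v) * (u ^+ i * v ^+ j) =
        r * v ^+ j * u ^+ i.+1 + s * (u ^+ i * v ^+ j.+1) by rewrite !exprS; ring.
    by apply: idealD => //; apply: idealMl.
  apply: weak_series_sub IH; apply: adjoin_sub; first exact: adjoin_ideal.
    by move=> z hz; apply: sub_adjoin; move: z hz; apply: ideal2_sub.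
  exact: adjoin_self.
have rows i : weak_series m (i * (D * w)) (ideal2 (u ^+ i) (v ^+ D)).
  elim: i => [|i IH]; first by exact: (@ideal2_l _ (u ^+ 0)).
  rewrite mulSn; apply: weak_series_sub (row _ _ IH D).
  apply: adjoin_sub => //; first exact: ideal2_ideal.
  by apply: idealMl; [exact: ideal2_ideal|exact: ideal2_r].
have -> : (c * c.+2 * w = c * w + c * (D * w))%N by rewrite /D; lia.
(* The last row stops one column early, at [E c c], whose extra generator [u^c v^c] is already in
   the ideal. *)
apply: weak_series_sub (row _ _ (rows c) c); apply: adjoin_sub => //.
  exact: ideal2_ideal.
by rewrite -exprMn.
Qed.

(** Bernoulli's inequality gives [(b+1)^t >= b^t (1 + t/b)], and [t = b w] makes the last factor
    [1 + w]. The auxiliary [h] is this inequality multiplied by [b]. *)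
Lemma expn_beats (b w : nat) : (0 < b)%N -> (b ^ (b * w) * w < b.+1 ^ (b * w))%N.
Proof.
move=> b0; have h t : (b * b ^ t + t * b ^ t <= b * b.+1 ^ t)%N.
  elim: t => [|t IH]; first by rewrite !expn0; lia.
  rewrite !expnS; have := leq_mul (leqnn b.+1) IH; set P := (b ^ t)%N; nia.
have := h (b * w)%N; rewrite -mulnA -mulnDr leq_pmul2l //; apply: leq_trans.
by rewrite [(w * _)%N]mulnC -[X in (X <= _)%N]add1n leq_add2r expn_gt0 b0.
Qed.

(** * Lower bounds for the length from contracted powers *)

Section SymbolicChain.
Variables (R : comPzRingType) (m : set R) (P0 P : Spec R) (x y : R).
Hypotheses (hR : noetherian R) (hm : local_ring_with m).
Hypotheses (P0P : point_ideal P0 `<=` point_ideal P).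
Hypotheses (Px : point_ideal P x) (P0x : ~ point_ideal P0 x).
Hypotheses (my : m y) (Py : ~ point_ideal P y).

(* The contraction of [x^i R_P] to R. *)
Definition local_power (i : nat) : set R :=
  [set r | exists s t, ~ point_ideal P s /\ s * r = t * x ^+ i].

Lemma local_power_ideal i : is_ideal (local_power i).
Proof.
split=> [|a b [s [t [Ps e]]] [s' [t' [Ps' e']]]|a b [s [t [Ps e]]]].
- by exists 1, 0; split; [exact: prime1|ring].
- exists (s * s'), (s' * t + s * t'); split; first exact: primeNM.
  transitivity (s' * (s * a) + s * (s' * b)); first by ring.
  by rewrite e e'; ring.
- by exists s, (a * t); split=> //; rewrite mulrCA e; ring.
Qed.

Lemma local_power_self i : local_power i (x ^+ i).
Proof. by exists 1, 1; split; [exact: prime1|]. Qed.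

Lemma local_powerS i : local_power i.+1 `<=` local_power i.
Proof. by move=> r [s [t [Ps e]]]; exists s, (t * x); rewrite e exprS mulrA. Qed.

Lemma local_power_cancel i s r : ~ point_ideal P s ->
  local_power i (s * r) -> local_power i r.
Proof.
move=> Ps [s' [t [Ps' e]]]; exists (s' * s), t; split; first exact: primeNM.
by rewrite -mulrA.
Qed.

(** Otherwise [s x^i = t x^(i+1)] with [s] outside [P]. Cancelling [x^i] modulo the prime [P0],
    which misses [x], puts [s - t x] in [P0], hence [s] in [P]. *)
Lemma local_power_strict i : ~ local_power i `<=` local_power i.+1.
Proof.
move=> /(_ _ (local_power_self i)) [s [t [Ps e]]]; apply: Ps.
have : point_ideal P0 (x ^+ i * (s - t * x)).
  have -> : x ^+ i * (s - t * x) = s * x ^+ i - t * x ^+ i.+1.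
    by rewrite exprS; ring.
  by rewrite e subrr; apply: ideal0; exact: primeI.
move=> /primeM[/primeX//|/P0P Pst].
rewrite -[s](subrK (t * x)); apply: idealD => //; first exact: primeI.
by apply: idealMl => //; exact: primeI.
Qed.

(** For fixed [i], lowering [j] from [M] to 0 climbs in [M] steps from [local_power i.+1 + (y^M)] to
    [local_power i + (y^M)]. *)
Definition step_ideal M i j : set R :=
  [set z | exists b c r, [/\ local_power i.+1 b, local_power i c &
    z = b + y ^+ j * c + y ^+ M * r]].

Lemma step_ideal_ideal M i j : is_ideal (step_ideal M i j).
Proof.
have h := local_power_ideal.
split=> [|_ _ [b [c [r [hb hc ->]]]] [b' [c' [r' [hb' hc' ->]]]]
         |a _ [b [c [r [hb hc ->]]]]].
- by exists 0, 0, 0; split; [exact: ideal0|exact: ideal0|ring].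
- exists (b + b'), (c + c'), (r + r').
  by split; [exact: idealD|exact: idealD|ring].
- by exists (a * b), (a * c), (a * r); split; [exact: idealMl|exact: idealMl|ring].
Qed.

(** Powers of [y] cancel modulo the contracted ideals, because [y] is outside [P]. If the two ideals
    were equal, cancelling [y^j] would give [local_power i = local_power i.+1 + y local_power i],
    and Nakayama's lemma would contradict [local_power_strict]. *)
Lemma step_ideal_strict M i j : (j < M)%N ->
  step_ideal M i j.+1 `<` step_ideal M i j.
Proof.
have h := local_power_ideal => jM; split.
  move=> _ [b [c [r [hb hc ->]]]]; exists b, (y * c), r.
  by split=> //; [exact: idealMl|rewrite exprS; ring].
move=> sub; apply: (@local_power_strict i).
apply: (nakayama hm hR (h i) (h i.+1) (@local_powerS i) my) => a ha.
have [|b [c [r [hb hc e]]]] := sub (y ^+ j * a).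
  by exists 0, a, 0; split=> //; [exact: ideal0|ring].
pose d := a - y * c - y ^+ (M - j) * r.
have hd : local_power i.+1 d.
  apply: (@local_power_cancel _ (y ^+ j)); first exact: primeNX.
  suff -> : y ^+ j * d = b by [].
  have eM : y ^+ M = y ^+ j * y ^+ (M - j) by rewrite -exprD subnKC // ltnW.
  by rewrite /d !mulrBr e exprS eM; ring.
have hr : local_power i r.
  apply: (@local_power_cancel _ (y ^+ (M - j))); first exact: primeNX.
  have -> : y ^+ (M - j) * r = a - y * c - d by rewrite /d; ring.
  apply: idealB => //; last exact: local_powerS.
  by apply: idealB => //; apply: idealMl.
exists d, (c + y ^+ (M - j).-1 * r); split=> //.
  by apply: idealD => //; apply: idealMl.
by rewrite mulrDr mulrA -exprS prednK ?subn_gt0 // /d; ring.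
Qed.

Lemma step_ideal_chain M i j : (j <= M)%N ->
  strict_chain (i * M + j) (step_ideal M i j).
Proof.
elim: i j => [|i IHi]; elim=> [//|j IHj] jM.
- rewrite addnS /=; exists (step_ideal M 0 j); split; last exact/IHj/ltnW.
    exact: step_ideal_ideal.
  exact: step_ideal_strict.
(* [step_ideal M i.+1 0] lies in [step_ideal M i M], so the chains for consecutive [i] can be
   joined. *)
- rewrite addn0 mulSn addnC; apply: strict_chain_sub (IHi M (leqnn M)).
  move=> _ [b [c [r [hb hc ->]]]]; exists (b + c), 0, r.
  split; last by rewrite expr0; ring.
    by apply: idealD => //; [exact: local_power_ideal|exact: local_powerS].
  by apply: ideal0; exact: local_power_ideal.
- rewrite addnS /=; exists (step_ideal M i.+1 j); split; last exact/IHj/ltnW.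
    exact: step_ideal_ideal.
  exact: step_ideal_strict.
Qed.

Lemma power_chain N M : strict_chain (N * M) (ideal2 (x ^+ N) (y ^+ M)).
Proof.
have := @step_ideal_chain M N 0 (leq0n _); rewrite addn0.
apply: strict_chain_sub; apply: ideal2_sub; first exact: step_ideal_ideal.
- exists 0, (x ^+ N), 0; split; [|exact: local_power_self|rewrite expr0; ring].
  by apply: ideal0; exact: local_power_ideal.
- exists 0, 0, 1; have h := local_power_ideal.
  by split; [exact: ideal0|exact: ideal0|ring].
Qed.

(** With [D = c + 1] and [b = c (c+2) = D^2 - 1], the length of [R/(x^(D^t), y^(D^t))] is at most
    [b^t w] by iterating [weak_series_square], and at least [D^(2t) = (b+1)^t] by [power_chain].
    These bounds clash at [t = b w]. *)
Lemma not_monomial_relation :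
  (forall p : Spec R, point_ideal p x -> point_ideal p y -> point_ideal p = m) ->
  ~ monomial_relation x y.
Proof.
move=> xym /monomial_relation_uniform [c c0 hc].
have [w hw] : exists w, weak_series m w (ideal2 x y).
  apply: (exists_weak_series hR (ideal2_ideal x y)) => p hp.
  by apply: xym; apply: hp; [exact: ideal2_l|exact: ideal2_r].
pose D := c.+1; pose b := (c * c.+2)%N.
have hD t : weak_series m (b ^ t * w) (ideal2 (x ^+ (D ^ t)) (y ^+ (D ^ t))).
  elim: t => [|t IH]; first by rewrite !expn0 mul1n !expr1.
  (* The uniform relation for [N = D^t] is the hypothesis of [weak_series_square] for [u = x^(D^t)]
     and [v = y^(D^t)]; the constant [c] is the same at every stage. *)
  have e : (c * D ^ t + D ^ t = D ^ t * c.+1)%N by rewrite /D; lia.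
  have := hc (D ^ t)%N; rewrite e [(c * _)%N]mulnC !exprM exprMn.
  move=> /(weak_series_square IH).
  by rewrite -!exprM -/D -expnSr mulnA -expnS.
have hb t : (b.+1 ^ t <= b ^ t * w)%N.
  have := strict_chain_le hm (ideal2_ideal _ _) (ideal2_ideal _ _)
    (fun z hz => hz) (hD t) (power_chain _ _).
  apply: leq_trans; rewrite -expnMn.
  by rewrite /b /D; have -> : (c.+1 * c.+1 = (c * c.+2).+1)%N by lia.
have b0 : (0 < b)%N by rewrite /b muln_gt0 c0.
by have := leq_ltn_trans (hb (b * w)%N) (expn_beats w b0); rewrite ltnn.
Qed.

End SymbolicChain.

(** * Parameters in dimension two *)

(** If [x] avoids [l] but lies in the new prime [p], add some [y] in [I] outside [p] that lies in
    every [q] of [l] not contained in [p]. Then [x + y] avoids [p], hence the [q] inside [p], and it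
    avoids the other [q] because [x] does. *)
Lemma prime_avoidance (R : comPzRingType) (I : set R) (l : seq (Spec R)) :
  is_ideal I -> (forall p, p \in l -> ~ I `<=` point_ideal p) ->
  exists2 x, I x & forall p, p \in l -> ~ point_ideal p x.
Proof.
move=> hI; elim: l => [|p l IH] hl; first by exists 0; [exact: ideal0|].
have [q ql|x Ix hx] := IH; first by apply: hl; rewrite inE ql orbT.
have [px|px] := pselect (point_ideal p x); last first.
  by exists x => // q; rewrite inE => /orP[/eqP->//|]; exact: hx.
have [y [Iy py hy]] : exists y, [/\ I y, ~ point_ideal p y &
    forall q, q \in l -> ~ point_ideal q `<=` point_ideal p -> point_ideal q y].
  elim: {IH hx} l hl => [|q l IH] hl.
    have /existsNP[y /not_implyP[Iy py]] := hl p (mem_head _ _).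
    by exists y; split.
  have [r|y [Iy py hy]] := IH.
    by rewrite inE => /orP[/eqP->|rl]; apply: hl; rewrite !inE ?eqxx ?rl ?orbT.
  have [qp|/existsNP[z /not_implyP[qz pz]]] :=
    pselect (point_ideal q `<=` point_ideal p).
    by exists y; split=> // r; rewrite inE => /orP[/eqP->//|]; exact: hy.
  exists (z * y); split; [exact: idealMl|exact: primeNM|move=> r].
  rewrite inE => /orP[/eqP-> _|rl rp]; first by apply: idealMr => //; exact: primeI.
  by apply: idealMl; [exact: primeI|exact: hy].
have pxy : ~ point_ideal p (x + y).
  by move=> /(ideal_cancell (primeI p) px).
exists (x + y); first exact: idealD.
move=> q; rewrite inE => /orP[/eqP->//|ql qxy].
have [qp|nqp] := pselect (point_ideal q `<=` point_ideal p).
  exact/pxy/qp.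
apply: (hx q ql); apply: ideal_cancelr qxy; [exact: primeI|exact: hy].
Qed.

(** Noetherian induction: if [ab] is in [I] but neither factor is, every prime above [I] is above
    [I + (a)] or [I + (b)], and the two lists are concatenated. *)
Lemma finite_minimal_primes (R : comPzRingType) (hR : noetherian R) (I : set R) :
  is_ideal I -> exists l : seq (Spec R),
    (forall p, p \in l -> I `<=` point_ideal p) /\
    (forall q : Spec R, I `<=` point_ideal q ->
       exists2 p, p \in l & point_ideal p `<=` point_ideal q).
Proof.
move: I; apply: (noetherian_ind hR) => I hI IH.
have [I1|nI1] := pselect (I 1).
  by exists [::]; split=> // q /(_ _ I1)/prime1.
have [pI|npI] := pselect (prime_ideal I).
  exists [:: SpecPoint pI]; split=> [p|q Iq]; first by rewrite inE => /eqP->.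
  by exists (SpecPoint pI); first exact: mem_head.
have [a [b [Iab nIa nIb]]] : exists a b, [/\ I (a * b), ~ I a & ~ I b].
  apply: contrapT => h; apply: npI; split=> // a b Iab.
  by apply: contrapT => /not_orP[nIa nIb]; apply: h; exists a, b.
have bigger c : ~ I c -> ~ adjoin I c `<=` I.
  by move=> nIc /(_ _ (adjoin_self c hI)).
have [la [ha1 ha2]] := IH _ (adjoin_ideal a hI) (@sub_adjoin _ I a) (bigger _ nIa).
have [lb [hb1 hb2]] := IH _ (adjoin_ideal b hI) (@sub_adjoin _ I b) (bigger _ nIb).
exists (la ++ lb); split=> [p|q Iq].
  by rewrite mem_cat => /orP[/ha1|/hb1]; apply: subset_trans; apply: sub_adjoin.
have /primeM[qa|qb] := Iq _ Iab.
  have [|p pl pq] := ha2 q; first by apply: adjoin_sub => //; exact: primeI.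
  by exists p => //; rewrite mem_cat pl.
have [|p pl pq] := hb2 q; first by apply: adjoin_sub => //; exact: primeI.
by exists p => //; rewrite mem_cat pl orbT.
Qed.

Lemma proper_trans (T : Type) (X Y Z : set T) : X `<` Y -> Y `<` Z -> X `<` Z.
Proof.
move=> [XY YX] [YZ ZY]; split; first exact: subset_trans YZ.
by move=> ZX; apply: YX; apply: subset_trans ZX.
Qed.

Section DimensionTwo.
Variables (R : comPzRingType) (m : set R).
Hypotheses (hR : noetherian R) (hm : local_ring_with m) (hd : krull_dim R 2).

Lemma no_chain4 (p q r s : Spec R) : point_ideal p `<` point_ideal q ->
  point_ideal q `<` point_ideal r -> point_ideal r `<` point_ideal s -> False.
Proof.
move=> pq qr rs; have [_ /(_ 3%N (fun i => nth p [:: p; q; r; s] i))] := hd.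
suff h : prime_chain (fun i : 'I_4 => nth p [:: p; q; r; s] i) by move=> /(_ h).
have pr := proper_trans pq qr; have qs := proper_trans qr rs.
have ps := proper_trans pq qs.
by move=> [[|[|[|[|i]]]] hi] [[|[|[|[|j]]]] hj].
Qed.

(** For primes [p0 < p1 < m], choose [x] in [p1] and [y] in [m] by prime avoidance so that any prime
    [p] other than [m] containing both would give four primes in a chain. Since [x] is not in [p0]
    and [y] is not in [p1], [not_monomial_relation] applies. *)
Lemma exists_independent_parameters : exists x y : R,
  [/\ m x, m y, forall p : Spec R, point_ideal p x -> point_ideal p y ->
        point_ideal p = m & ~ monomial_relation x y].
Proof.
have [[c hc] _] := hd; pose p0 := c ord0; pose p1 := c (inord 1).
have p01 : point_ideal p0 `<` point_ideal p1 by apply: hc; rewrite inordK.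
have p1m : point_ideal p1 `<` m.
  have [h1 h2] : point_ideal p1 `<` point_ideal (c (inord 2)).
    by apply: hc; rewrite !inordK.
  split; first exact: local_prime_sub.
  by move=> mp1; apply: h2; apply: subset_trans mp1; exact: local_prime_sub.
have proper_m (q : Spec R) : point_ideal q <> m ->
    point_ideal q `<` point_ideal (closed_point hm).
  move=> nqm; split; first exact: local_prime_sub.
  by move=> mq; apply: nqm; apply/seteqP; split=> //; exact: local_prime_sub.
have hi0 := zero_ideal R.
have [l [_ hl]] := finite_minimal_primes hR hi0.
(* [x] has to avoid [p0] and those primes of [l], the list below all primes, that do not contain
   [p1]. *)
have [|x p1x hx] := @prime_avoidance R (point_ideal p1)
  [seq p <- p0 :: l | ~~ `[< point_ideal p1 `<=` point_ideal p >]] (primeI p1).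
  by move=> p; rewrite mem_filter => /andP[/asboolPn].
have p0x : ~ point_ideal p0 x.
  apply: hx; rewrite mem_filter mem_head andbT; apply/asboolPn.
  by have [] := p01.
have [l' [hl1 hl2]] := finite_minimal_primes hR (adjoin_ideal x hi0).
have [|y my hy] := @prime_avoidance R m
  [seq p <- p1 :: l' | ~~ `[< m `<=` point_ideal p >]] (local_ideal hm).
  by move=> p; rewrite mem_filter => /andP[/asboolPn].
have p1y : ~ point_ideal p1 y.
  apply: hy; rewrite mem_filter mem_head andbT; apply/asboolPn.
  by have [] := p1m.
have mx : m x by apply: (local_prime_sub hm p1x).
have xym p : point_ideal p x -> point_ideal p y -> point_ideal p = m.
  move=> px py; apply: contrapT => /proper_m pm.
  have [|q ql qp] := hl2 p.
    apply: adjoin_sub => //; first exact: primeI.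
    by move=> _ ->; apply: ideal0; exact: primeI.
  have qx : point_ideal q x.
    by apply: (hl1 q ql); apply: adjoin_self.
  have qp' : point_ideal q `<` point_ideal p.
    split=> // pq; have [_] := pm; apply=> /=.
    apply: contrapT => nmp; apply: (hy q) => //; last exact: pq.
    rewrite mem_filter inE ql orbT andbT; apply/asboolPn => mq; apply: nmp.
    exact: subset_trans mq qp.
  have [|r rl rq] := hl q.
    by move=> _ ->; apply: ideal0; exact: primeI.
  (* If [r] contains [p1], the chain is [p0 < p1 < p < m], with [y] separating [p] from [p1];
     otherwise it is [r < q < p < m], with [x] separating [q] from [r]. *)
  have [p1r|np1r] := pselect (point_ideal p1 `<=` point_ideal r).
    apply: (@no_chain4 p0 p1 p (closed_point hm)) => //.
    split; first by apply: subset_trans qp; apply: subset_trans rq.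
    by move=> pp1; apply: p1y; apply: pp1.
  apply: (@no_chain4 r q p (closed_point hm)) => //.
  split=> // qr; apply: (hx r); last exact: qr.
  by rewrite mem_filter inE rl orbT andbT; apply/asboolPn.
exists x, y; split=> //.
have [p0p1 _] := p01.
exact: (@not_monomial_relation R m p0 p1).
Qed.

End DimensionTwo.

(** * Sections of the structure sheaf *)

Section ToLoc.
Variables (A : comPzRingType) (S : mulSet A).

Lemma to_loc_zmod : zmod_morphism (to_loc S).
Proof. by move=> a b; rewrite /to_loc locN locD; apply: frac_congr; ring. Qed.

Lemma to_loc_monoid : monoid_morphism (to_loc S).
Proof. by split=> // a b; rewrite /to_loc locM; apply: frac_congr; ring. Qed.

HB.instance Definition _ :=
  GRing.isZmodMorphism.Build A (loc S) (to_loc S) to_loc_zmod.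
HB.instance Definition _ :=
  GRing.isMonoidMorphism.Build A (loc S) (to_loc S) to_loc_monoid.

Lemma to_loc_eq0 a : to_loc S a = 0 <-> exists2 u, mul_set S u & u * a = 0.
Proof.
split=> [/fracE[u Su e]|[u Su e]]; last first.
  by apply/fracE; exists u => //; rewrite mul0r mulr0 mulr1.
by exists u => //; move: e; rewrite mul0r mulr0 mulr1.
Qed.

Lemma mkfrac_den (a s : A) (Ss : mul_set S s) :
  to_loc S s * mkfrac a Ss = to_loc S a.
Proof. by rewrite /to_loc locM; apply: frac_congr; ring. Qed.

Lemma to_loc_unit_cancel (s : A) (z w : loc S) : mul_set S s ->
  to_loc S s * z = to_loc S s * w -> z = w.
Proof.
move=> Ss /(congr1 (fun v => mkfrac 1 Ss * v)).
have e v : mkfrac 1 Ss * (to_loc S s * v) = v.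
  by rewrite mulrA [_ * to_loc _ _]mulrC mkfrac_den mul1r.
by rewrite !e.
Qed.

(** Multiplying out allows statements on fractions that carry no membership proof for the
    denominator. *)
Lemma mkfracP (a s : A) (Ss : mul_set S s) (z : loc S) :
  to_loc S s * z = to_loc S a <-> z = mkfrac a Ss.
Proof.
split=> [e|->]; last exact: mkfrac_den.
by apply: (to_loc_unit_cancel Ss); rewrite e mkfrac_den.
Qed.

End ToLoc.

Section SecConst.
Variables (A : comPzRingType) (U : set (Spec A)).

Lemma sec_const_zmod : zmod_morphism (@sec_const A U).
Proof. by move=> a b; apply: section_eq => p Up /=; rewrite rmorphB. Qed.

Lemma sec_const_monoid : monoid_morphism (@sec_const A U).
Proof. by split=> [//|a b]; apply: section_eq => p Up /=; rewrite rmorphM. Qed.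

HB.instance Definition _ :=
  GRing.isZmodMorphism.Build A (section U) (@sec_const A U) sec_const_zmod.
HB.instance Definition _ :=
  GRing.isMonoidMorphism.Build A (section U) (@sec_const A U) sec_const_monoid.

Lemma secM (s t : section U) p Up : (s * t) p Up = s p Up * t p Up.
Proof. by []. Qed.

Lemma secB (s t : section U) p Up : (s - t) p Up = s p Up - t p Up.
Proof. by []. Qed.

Lemma secD (s t : section U) p Up : (s + t) p Up = s p Up + t p Up.
Proof. by []. Qed.

Lemma sec_constE a p Up : sec_const U a p Up = to_loc (prime_compl p) a.
Proof. by []. Qed.

End SecConst.

Lemma nonzeros1 (A : comPzRingType) (f : A) (p : Spec A) :
  nonzeros [set f] p <-> ~ point_ideal p f.
Proof. by split=> [h h'|h h']; apply: h; [move=> _ ->|apply: h']. Qed.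

Lemma nonzeros2 (A : comPzRingType) (f g : A) (p : Spec A) :
  nonzeros [set f; g] p <-> ~ point_ideal p f \/ ~ point_ideal p g.
Proof.
split=> [h|h h']; last by case: h; apply; apply: h'; [left|right].
by apply: contrapT => /not_orP[/contrapT pf /contrapT pg]; apply: h => _ [] ->.
Qed.

Lemma open_nonzeros (A : comPzRingType) (E : set A) : open (nonzeros E).
Proof. by exists E. Qed.

Lemma open_basic (A : comPzRingType) (V : set (Spec A)) p : open V -> V p ->
  exists e, ~ point_ideal p e /\ forall q : Spec A, ~ point_ideal q e -> V q.
Proof.
move=> [E ->] /existsNP[e /not_implyP[Ee pe]]; exists e; split=> // q qe h.
by apply: qe; apply: h.
Qed.

(** If no power of [g] killed [a], some prime avoiding [g] would contain the annihilator of [a], and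
    so the given [u]. *)
Lemma annihilator_power (A : comPzRingType) (a g : A) :
  (forall q : Spec A, ~ point_ideal q g -> exists2 u, ~ point_ideal q u & u * a = 0) ->
  exists N, g ^+ N * a = 0.
Proof.
move=> h; have hI : is_ideal (colon [set 0] a).
  exact/colon_ideal/zero_ideal.
apply: contrapT => /forallNP hg.
have [q [Iq qg]] := exists_prime_avoiding hI hg.
by have [u qu ua] := h q qg; apply/qu/Iq.
Qed.

Section BasicOpens.
Variables (A : comPzRingType) (U : set (Spec A)).

(** Multiplying numerator and denominator by some [e] with D(e) inside the given neighbourhood makes
    the denominator alone describe where the fraction is valid. *)
Lemma section_basic (s : section U) p (Up : U p) : exists a h, ~ point_ideal p h /\
  forall q (Uq : U q), ~ point_ideal q h ->
    to_loc (prime_compl q) h * s q Uq = to_loc (prime_compl q) a.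
Proof.
have [V [a [f [oV Vp h]]]] := sec_frac s Up.
have [e [pe eV]] := open_basic oV Vp.
have [pf _] := h p Up Vp.
exists (e * a), (e * f); split; first exact: primeNM.
move=> q Uq qef; have [|qf ->] := h q Uq.
  by apply: eV => qe; apply: qef; apply: idealMr => //; exact: primeI.
by rewrite rmorphM -mulrA mkfrac_den rmorphM.
Qed.

Section OnBasicOpen.
Variable f : A.
Hypothesis fU : forall q : Spec A, ~ point_ideal q f -> U q.

(* Quasi-compactness is replaced by the observation that the [r] for which one
   power of [h] kills [t] on D(f r) form an ideal. *)
Lemma basic_vanish (t : section U) (h : A) :
  (forall q Uq, ~ point_ideal q f -> ~ point_ideal q h -> t q Uq = 0) ->
  exists N, forall q Uq, ~ point_ideal q f ->
    to_loc (prime_compl q) (h ^+ N) * t q Uq = 0.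
Proof.
move=> ht; pose J := [set r | exists N, forall q Uq,
  ~ point_ideal q f -> ~ point_ideal q r -> to_loc (prime_compl q) (h ^+ N) * t q Uq = 0].
have hJ : is_ideal J.
  split=> [|r r' [N hN] [N' hN']|r r' [N hN]].
  - by exists 0%N => q _ _ []; apply: ideal0; exact: primeI.
  - exists (N + N')%N => q Uq qf qr; rewrite exprD rmorphM.
    have [qr1|nqr] := pselect (point_ideal q r); last by rewrite mulrAC hN // mul0r.
    rewrite -mulrA hN' ?mulr0 // => qr2; apply: qr.
    by apply: idealD => //; exact: primeI.
  - exists N => q Uq qf qr; apply: hN => // qr'; apply: qr.
    by apply: idealMl => //; exact: primeI.
suff [n [N hN]] : exists n, J (f ^+ n).
  by exists N => q Uq qf; apply: hN => //; exact: primeNX.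
apply: contrapT => /forallNP fJ.
have [P [JP Pf]] := exists_prime_avoiding hJ fJ.
have [a [k [Pk hk]]] := section_basic t (fU Pf).
apply: Pk; apply: JP.
(* Near [P] the section [t] is [a / k]. It vanishes on D(h k f), so a power of [h k f] kills [a];
   this puts [k] in [J]. *)
have [q qhkf|N hN] := @annihilator_power A a (h * k * f).
  have qI := primeI q.
  have qf : ~ point_ideal q f by move=> ?; apply: qhkf; apply: idealMl.
  have qh : ~ point_ideal q h by move=> ?; apply: qhkf; do 2!apply: idealMr => //.
  have qk : ~ point_ideal q k.
    by move=> ?; apply: qhkf; apply: idealMr => //; apply: idealMl.
  have := hk q (fU qf) qk; rewrite ht // mulr0 => /esym/to_loc_eq0[u qu ua].
  by exists u.
exists N => q Uq qf qk; apply: (@to_loc_unit_cancel _ _ k) => //.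
rewrite mulr0 mulrCA hk // -rmorphM; apply/to_loc_eq0.
exists ((k * f) ^+ N); first by apply: primeNX; apply: primeNM.
by rewrite mulrA -exprMn [k * f * h]mulrC mulrA hN.
Qed.

(** The [r] for which [r s] comes from [A] on D(f) form an ideal. Were it free of powers of [f], it
    would lie in a prime [P] missing [f]. But if [s = a / k] near [P], then [k s - a] vanishes on
    D(f k) and is killed by some [k^N] on D(f), so the ideal contains [k^(N+1)], which is outside
    [P]. *)
Lemma basic_section (s : section U) : exists n c, forall q Uq, ~ point_ideal q f ->
  to_loc (prime_compl q) (f ^+ n) * s q Uq = to_loc (prime_compl q) c.
Proof.
pose I := [set r | exists c, forall q Uq, ~ point_ideal q f ->
  to_loc (prime_compl q) r * s q Uq = to_loc (prime_compl q) c].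
have hI : is_ideal I.
  split=> [|r r' [c hc] [c' hc']|r r' [c hc]].
  - by exists 0 => q Uq _; rewrite rmorph0 mul0r.
  - by exists (c + c') => q Uq qf; rewrite !rmorphD mulrDl hc ?hc'.
  - by exists (r * c) => q Uq qf; rewrite !rmorphM -mulrA hc.
suff [n [c hc]] : exists n, I (f ^+ n) by exists n, c.
apply: contrapT => /forallNP fI.
have [P [IP Pf]] := exists_prime_avoiding hI fI.
have [a [k [Pk hk]]] := section_basic s (fU Pf).
have [q Uq qf qk|N hN] := @basic_vanish (sec_const U k * s - sec_const U a) k.
  by rewrite secB secM !sec_constE hk // subrr.
apply: (@primeNX _ P k N.+1 Pk); apply: IP; exists (k ^+ N * a) => q Uq qf.
have := hN q Uq qf; rewrite secB secM !sec_constE mulrBr => /subr0_eq.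
by rewrite mulrA -!rmorphM -exprSr.
Qed.

End OnBasicOpen.

(** On D(f) some [f^n s] agrees with an element [c] of [A]. The difference vanishes on D(f), so by
    [basic_vanish] a further power of [f] kills it on D(g) too. *)
Lemma section_extend (f g : A) (s : section U) : U = nonzeros [set f; g] ->
  exists n c, sec_const U (f ^+ n) * s = sec_const U c.
Proof.
move=> eU; have Uf (q : Spec A) : ~ point_ideal q f -> U q by rewrite eU nonzeros2; left.
have Ug (q : Spec A) : ~ point_ideal q g -> U q by rewrite eU nonzeros2; right.
have [n [c hc]] := basic_section Uf s.
have [q Uq qg qf|N hN] :=
  basic_vanish Ug (t := sec_const U (f ^+ n) * s - sec_const U c) (h := f).
  by rewrite secB secM !sec_constE hc // subrr.
exists (N + n)%N, (f ^+ N * c); apply: section_eq => q Uq.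
rewrite secM !sec_constE exprD !rmorphM -mulrA.
have [qf|qf] := pselect (point_ideal q f); last by rewrite hc.
have [//|qg] : ~ point_ideal q f \/ ~ point_ideal q g by apply/nonzeros2; rewrite -eU.
by have := hN q Uq qg; rewrite secB secM !sec_constE mulrBr => /subr0_eq.
Qed.

End BasicOpens.

(** * Top Cech cohomology *)

Lemma cech_class_eq0 (A : comPzRingType) d (y : 'I_d -> A) (z : cech_top y) :
  cech_class z = 0 <-> exists b, z = cech_diff b.
Proof.
have -> : (0 : cech_H y) = (\pi_(cech_H y) 0)%qT by rewrite piE.
split=> [/eqmodP|h]; last apply/eqmodP; rewrite /= /Quotient.equiv subr0.
  by move/asboolP.
exact/asboolP.
Qed.

Lemma powers_X (A : comPzRingType) (f : A) n : mul_set (powers f) (f ^+ n).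
Proof. by exists n. Qed.

Lemma frac_powers (A : comPzRingType) (f : A) (z : loc (powers f)) :
  exists a n, z = mkfrac a (powers_X f n).
Proof.
have [a [s [[n es] ->]]] := frac_surj z.
by exists a, n; apply: frac_congr; rewrite es.
Qed.

Lemma frac_powersE (A : comPzRingType) (f a b : A) n k :
  mkfrac a (powers_X f n) = mkfrac b (powers_X f k) <->
  exists N, f ^+ N * (a * f ^+ k) = f ^+ N * (b * f ^+ n).
Proof.
split=> [/fracE[_ [N ->] e]|[N e]]; first by exists N.
by apply/fracE; exists (f ^+ N) => //; exists N.
Qed.

Section CechTop.
Variables (A : comPzRingType) (d : nat) (y : 'I_d -> A).

Lemma cech_classP (c : cech_H y) :
  exists a n, c = cech_class (mkfrac a (powers_X (\prod_i y i) n) : cech_top y).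
Proof.
have [a [n e]] := frac_powers (repr c : cech_top y).
by exists a, n; rewrite -e /cech_class reprK.
Qed.

Lemma paraclassE : paraclass y =
  cech_class (mkfrac 1 (powers_X (\prod_i y i) 1) : cech_top y).
Proof. by congr cech_class; apply: frac_congr; rewrite expr1. Qed.

Lemma cech_face_map k a n :
  loc_map (@cech_face_inverts A d y k)
    (mkfrac a (powers_X (\prod_(i | i != k) y i) n)) =
  mkfrac (a * y k ^+ n) (powers_X (\prod_i y i) n).
Proof.
have e : (\prod_(i | i != k) y i) ^+ n * y k ^+ n = (\prod_i y i) ^+ n.
  by rewrite -exprMn [in RHS](bigD1 k) //= mulrC.
have T : mul_set (powers (\prod_i y i))
    (idfun ((\prod_(i | i != k) y i) ^+ n) * y k ^+ n).
  by rewrite /= e; exists n.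
by rewrite (loc_mapE _ _ _ T); apply: frac_congr; rewrite /= e.
Qed.

End CechTop.

Lemma paraclass0_eq0 (A : comPzRingType) (y : 'I_0 -> A) :
  paraclass y = 0 <-> (1 : A) = 0.
Proof.
have diff0 (b : forall k, cech_face y k) : cech_diff b = 0 by exact: big_ord0.
rewrite paraclassE cech_class_eq0; split=> [[b]|A0].
  rewrite diff0 => /fracE[_ [n ->]].
  by rewrite big_ord0 !expr1n !mul1r mul0r.
exists (fun=> 0); rewrite diff0.
by apply: frac_congr; rewrite A0 !mul0r.
Qed.

Definition stable_power (A : comPzRingType) (f : A) : Prop :=
  exists k a, f ^+ k = a * f ^+ k.+1.

Section CechOne.
Variables (A : comPzRingType) (y : 'I_1 -> A).

Lemma cech1_eq0 a n :
  cech_class (mkfrac a (powers_X (\prod_i y i) n) : cech_top y) = 0 <->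
  exists N c, y ord0 ^+ N * a = c * y ord0 ^+ (N + n).
Proof.
have e : \prod_i y i = y ord0 by rewrite big_ord_recl big_ord0 mulr1.
have diff1 (b : forall k, cech_face y k) :
    cech_diff b = loc_map (@cech_face_inverts _ _ y ord0) (b ord0).
  by rewrite /cech_diff [LHS]big_ord_recl [X in _ + X]big_ord0 addr0 expr0 mul1r.
rewrite cech_class_eq0; split=> [[b]|[N [c h]]].
  rewrite diff1.
  have [c [k ->]] := frac_powers (b ord0); rewrite cech_face_map.
  move=> /frac_powersE[N]; rewrite e => h; exists (N + k)%N, c.
  by rewrite !exprD; move: h; rewrite [a * _]mulrC !mulrA => ->; ring.
exists (fun k => mkfrac c (powers_X (\prod_(i | i != k) y i) 0)).
rewrite diff1 cech_face_map.
apply/frac_powersE; exists N; rewrite e !expr0 !mulr1 h exprD; ring.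
Qed.

Lemma paraclass1_eq0 : paraclass y = 0 <-> stable_power (y ord0).
Proof.
rewrite paraclassE cech1_eq0; split=> [[N [c h]]|[N [c h]]]; exists N, c.
  by rewrite -[LHS]mulr1 h addn1.
by rewrite mulr1 h addn1.
Qed.

(** Iterating [y^k = b y^(k+1)] gives [y^k = b^n y^(k+n)], so [a / y^n] equals [a b^n] and is a
    coboundary. *)
Lemma stable_power_cech_eq0 : stable_power (y ord0) -> forall c : cech_H y, c = 0.
Proof.
move=> [k [b h]] c; have [a [n ->]] := cech_classP c.
apply/cech1_eq0; exists k, (a * b ^+ n); elim: n => [|n IH].
  by rewrite addn0; ring.
rewrite IH; have -> : y ord0 ^+ (k + n) = b * y ord0 ^+ (k + n.+1).
  by rewrite addnS -addSn exprD h exprD; ring.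
by rewrite exprSr; ring.
Qed.

End CechOne.

Section CechTwo.
Variables (A : comPzRingType) (y : 'I_2 -> A).
Let f := y ord0.
Let g := y ord_max.

Let lift0 : lift ord0 ord0 = ord_max :> 'I_2.
Proof. exact: val_inj. Qed.

Lemma cech2_eq0 a n :
  cech_class (mkfrac a (powers_X (\prod_i y i) n) : cech_top y) = 0 <->
  exists N b c, (f * g) ^+ N * a = b * f ^+ (N + n) + c * g ^+ (N + n).
Proof.
have e : \prod_i y i = f * g.
  by rewrite !big_ord_recl big_ord0 mulr1 lift0.
have diff2 (z : forall k, cech_face y k) b k c l :
    z ord0 = mkfrac b (powers_X _ k) -> z ord_max = mkfrac c (powers_X _ l) ->
    cech_diff z = mkfrac (b * f ^+ k * (f * g) ^+ l - c * g ^+ l * (f * g) ^+ k)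
      (powers_X (\prod_i y i) (k + l)).
  move=> ez1 ez2; rewrite /cech_diff [LHS]big_ord_recl [X in _ + X]big_ord_recl.
  rewrite [X in _ + (_ + X)]big_ord0 addr0 lift0.
  rewrite ez1 ez2 !cech_face_map expr0 mul1r expr1 mulN1r locN locD.
  by apply: frac_congr; rewrite e exprD -/f -/g; ring.
rewrite cech_class_eq0; split=> [[z]|[N [b [c h]]]].
  have [b [k ez1]] := frac_powers (z ord0).
  have [c [l ez2]] := frac_powers (z ord_max).
  rewrite (diff2 _ _ _ _ _ ez1 ez2) => /frac_powersE[N].
  rewrite e => h; exists (N + k + l)%N, (b * g ^+ (N + l + n)), (- c * f ^+ (N + k + n)).
  have -> : (f * g) ^+ (N + k + l) * a = (f * g) ^+ N * (a * (f * g) ^+ (k + l)).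
    by rewrite !exprD; ring.
  by rewrite h !exprMn !exprD; ring.
(* The sign of [- c] cancels the sign of the second face in the differential. *)
pose z k : cech_face y k := mkfrac (if k == ord0 then b else - c)
  (powers_X (\prod_(i | i != k) y i) (N + n)).
exists z; rewrite (diff2 z b (N + n)%N (- c) (N + n)%N) //.
apply/frac_powersE; exists N; rewrite e.
transitivity ((f * g) ^+ N * a * (f * g) ^+ (N + n + (N + n))); first by ring.
by rewrite h !exprMn !exprD; ring.
Qed.

Lemma paraclass2_eq0 : paraclass y = 0 <-> monomial_relation f g.
Proof.
rewrite paraclassE cech2_eq0; split=> [[N [b [c h]]]|[N [b [c h]]]]; exists N, b, c.
  by rewrite -[LHS]mulr1 h addn1.
by rewrite mulr1 h addn1.
Qed.

(** The relation itself only kills [1/(fg)]; its uniform form at [N = n] kills [1/(fg)^n], and hence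
    every class with that denominator. *)
Lemma monomial_relation_cech_eq0 :
  monomial_relation f g -> forall c : cech_H y, c = 0.
Proof.
move=> /monomial_relation_uniform[k _ h] c; have [a [n ->]] := cech_classP c.
have [r [s e]] := h n; apply/cech2_eq0; exists (k * n)%N, (r * a), (s * a).
by rewrite e; ring.
Qed.

End CechTwo.

(** * Affineness of D(f, g) *)

(** By [section_extend], [g^n s = a] and [f^k t = b] for some [a], [b] in [A]. Multiplying the given
    identity by [f^k g^n] yields [f^k g^n = a f^(k+1) + b g^(n+1)] over [U], and in [A] after
    multiplication by a power of [f]. *)
Lemma unit_sections_monomial_relation (A : comPzRingType) (U : set (Spec A))
    (f g : A) (s t : section U) : U = nonzeros [set f; g] ->
  s * sec_const U f + t * sec_const U g = 1 -> monomial_relation f g.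
Proof.
move=> eU e1.
have eU' : U = nonzeros [set g; f] by rewrite eU setUC.
have [n [a ea]] := section_extend s eU'.
have [k [b eb]] := section_extend t eU.
pose d := f ^+ k * g ^+ n - (a * f ^+ k.+1 + b * g ^+ n.+1).
have d0 : sec_const U d = 0.
  rewrite /d !(rmorphB, rmorphD, rmorphM) /= -ea -eb; apply/eqP; rewrite subr_eq0.
  rewrite -[X in X == _]mulr1 -e1 !exprS !rmorphM; apply/eqP; ring.
have [q qf|N hN] := @annihilator_power A d f.
  have Uq : U q by rewrite eU nonzeros2; left.
  have /to_loc_eq0[u qu ud] : to_loc (prime_compl q) d = 0.
    by rewrite -(sec_constE _ Uq) d0.
  by exists u.
(* The further factor [g^N f^n g^k] brings [f] and [g] to the common exponent [N + k + n]. *)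
exists (N + k + n)%N, (a * g ^+ (k + N)), (b * f ^+ (n + N)).
apply: subr0_eq; transitivity (f ^+ N * d * (g ^+ N * f ^+ n * g ^+ k)).
  by rewrite /d !exprMn !exprS !exprD; ring.
by rewrite hN mul0r.
Qed.

Lemma global_section_const (B : comPzRingType) (s : section [set: Spec B]) :
  exists c, s = sec_const setT c.
Proof.
have [|n [c e]] := @section_extend B setT 1 1 s.
  by apply/seteqP; split=> // p _; apply/nonzeros2; left; exact: prime1.
by exists c; rewrite -e expr1n rmorph1 mul1r.
Qed.

Lemma open_val (T : topologicalType) (U V : set T) :
  open V -> open (set_val @^-1` V : set U).
Proof. by move=> oV; exists V. Qed.

Lemma sec_inv_frac (A : comPzRingType) (V : set (Spec A)) (h : A)
    (hV : forall p, V p -> ~ point_ideal p h) :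
  locally_frac (fun p (Vp : V p) => mkfrac 1 (hV p Vp : mul_set (prime_compl p) h)).
Proof.
move=> p Vp; exists setT, 1, h; split=> //; first exact: openT.
by move=> q Vq _; exists (hV q Vq).
Qed.

(** The sections [f] and [g] correspond to elements [c] and [c'] of [B] without common zero, so
    [r c + s c' = 1] in [B]; transporting this identity back gives the unit relation over [U]. *)
Lemma affine_monomial_relation (A : comPzRingType) (U : set (Spec A)) (f g : A) :
  U = nonzeros [set f; g] -> affine (open_subscheme (spec_scheme A) U) ->
  monomial_relation f g.
Proof.
move=> eU [B [F [G [phi [[FK GK] [cF cG] phi_bij phi_nat]]]]].
pose X := open_subscheme (spec_scheme A) U.
pose T0 : set (Spec A) := set_val @` (F @^-1` setT).
pose phiT : {rmorphism section [set: Spec B] -> section T0} := phi setT openT.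
have lift h : exists c, phiT (sec_const setT c) = sec_const T0 h.
  have [psi _ psiK] := phi_bij setT openT.
  have [c ec] := global_section_const (psi (sec_const T0 h)).
  by exists c; rewrite -ec; exact: psiK.
have eT0 : T0 = nonzeros [set f; g].
  rewrite -eU; apply/seteqP; split=> [_ [u _ <-]|p Up]; first exact: set_valP.
  by exists (exist _ p (mem_set Up)).
(* The isomorphism is only one of ringed spaces, so nonvanishing is transported as invertibility:
   [h] has an inverse over D(h), hence [c] has one over the matching open set [W], and a unit of the
   stalk at [q] is not in [q]. *)
have nonvanish h c (q : Spec B) : phiT (sec_const setT c) = sec_const T0 h ->
    ~ point_ideal (set_val (G q)) h -> ~ point_ideal q c.
  move=> ec hq qc.
  pose W : set (Spec B) := G @^-1` (set_val @^-1` nonzeros [set h]).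
  have oW : open W.
    apply: open_comp; first by move=> ? _; exact: cG.
    by apply: open_val; exact: open_nonzeros.
  have Wq : W q by apply/nonzeros1.
  have WT : W `<=` setT by [].
  pose V : set (Spec A) := set_val @` (F @^-1` W).
  pose phiW : {rmorphism section W -> section V} := phi W oW.
  have hV p : V p -> ~ point_ideal p h.
    by move=> [u Wu <-]; move: Wu; rewrite /W /= FK => /nonzeros1.
  pose i : section V := Section_ (sec_inv_frac hV).
  have hi : sec_const V h * i = 1.
    by apply: section_eq => p Vp; rewrite secM sec_constE /= mkfrac_den.
  have [psi psiK psiK'] := phi_bij W oW.
  have e1 : phiW (sec_const W c) = sec_const V h.
    have := phi_nat _ _ openT oW WT (sec_const setT c).
    have -> : phi setT openT (sec_const setT c) = sec_const T0 h by [].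
    move=> /esym; set l := LHS; have -> : l = phiW (sec_const W c).
      by congr (phi W oW _); apply: section_eq.
    by move=> ->; apply: section_eq.
  have : sec_const W c * psi i = 1.
    apply: (can_inj psiK); rewrite -[LHS]/(phiW _) -[RHS]/(phiW _).
    rewrite rmorphM rmorph1 e1 -hi; congr (_ * _); exact: psiK'.
  move=> /(congr1 (fun s : section W => s q Wq)).
  rewrite secM sec_constE; have [a [s [qs ->]]] := frac_surj ((psi i : section W) q Wq).
  rewrite /to_loc locM => /fracE[u qu].
  rewrite !mulr1 !mul1r => e; apply: (primeNM qu qs); rewrite -e.
  by apply: idealMl; [exact: primeI|apply: idealMr => //; exact: primeI].
have [c ec] := lift f; have [c' ec'] := lift g.
have [r [s e1]] : ideal2 c c' 1.
  apply: contrapT => n1.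
  have [|q [Iq _]] := exists_prime_avoiding (f := 1) (ideal2_ideal c c').
    by move=> n; rewrite expr1n.
  have Uv : U (set_val (G q)) by exact: set_valP.
  have [] : ~ point_ideal (set_val (G q)) f \/ ~ point_ideal (set_val (G q)) g.
  - by apply/nonzeros2; rewrite -[X in X _]eU.
  - by move=> /(nonvanish f c q ec); apply; apply: Iq; exact: ideal2_l.
  - by move=> /(nonvanish g c' q ec'); apply; apply: Iq; exact: ideal2_r.
apply: (unit_sections_monomial_relation (s := phiT (sec_const setT r))
  (t := phiT (sec_const setT s)) eT0).
rewrite -ec -ec' -[RHS](rmorph1 phiT).
by rewrite -[1](rmorph1 (@sec_const _ _)) e1 !rmorphD !rmorphM.
Qed.

(** * From a monomial relation to a unit relation between sections *)

Section Glue.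
Variables (A : comPzRingType) (U : set (Spec A)).

(** At each point one denominator is a unit and determines the value; the cross relation then gives
    the equation for the other. Being uniquely solvable, these equations turn the chosen values into
    local fractions. *)
Lemma glue_fractions (a h a' h' : A) :
  (forall p, U p -> ~ point_ideal p h \/ ~ point_ideal p h') ->
  a * h' = a' * h -> exists s : section U, forall p Up,
    to_loc (prime_compl p) h * s p Up = to_loc _ a /\
    to_loc (prime_compl p) h' * s p Up = to_loc _ a'.
Proof.
move=> cover e; have ex p (Up : U p) : exists z : stalk p,
    to_loc (prime_compl p) h * z = to_loc _ a /\
    to_loc (prime_compl p) h' * z = to_loc _ a'.
  have [ph|ph] := cover p Up.
    exists (mkfrac a (ph : mul_set (prime_compl p) h)).
    rewrite mkfrac_den; split=> //; apply: (to_loc_unit_cancel (s := h)) => //.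
    by rewrite mulrCA mkfrac_den -!rmorphM mulrC e mulrC.
  exists (mkfrac a' (ph : mul_set (prime_compl p) h')).
  rewrite mkfrac_den; split=> //; apply: (to_loc_unit_cancel (s := h')) => //.
  by rewrite mulrCA mkfrac_den -!rmorphM mulrC -e mulrC.
pose v p Up := sval (cid (ex p Up)).
have vP p Up : to_loc (prime_compl p) h * v p Up = to_loc _ a /\
    to_loc (prime_compl p) h' * v p Up = to_loc _ a' := svalP (cid (ex p Up)).
have lv : locally_frac v.
  move=> p Up; have [ph|ph] := cover p Up.
    exists (nonzeros [set h]), a, h; split; [exact: open_nonzeros|exact/nonzeros1|].
    move=> q Uq /nonzeros1 qh; exists qh; apply/mkfracP.
    by have [] := vP q Uq.
  exists (nonzeros [set h']), a', h'; split; [exact: open_nonzeros|exact/nonzeros1|].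
  move=> q Uq /nonzeros1 qh; exists qh; apply/mkfracP.
  by have [] := vP q Uq.
by exists (Section_ lv).
Qed.

(** The sections are [s = a / g^k] and [t = b / f^k], extended by [(f^k - b g) / f^(k+1)] and
    [(g^k - a f) / g^(k+1)]. Writing [s] as [a g / g^(k+1)], and [t] likewise, gives both the same
    denominators for the final check. *)
Lemma monomial_relation_unit_sections (f g : A) : U = nonzeros [set f; g] ->
  monomial_relation f g ->
  exists s t : section U, s * sec_const U f + t * sec_const U g = 1.
Proof.
move=> eU [k [a [b e]]].
have cover p : U p -> ~ point_ideal p f \/ ~ point_ideal p g.
  by rewrite eU => /nonzeros2.
have [||s hs] := @glue_fractions (a * g) (g ^+ k.+1) (f ^+ k - b * g) (f ^+ k.+1).
- by move=> p /cover[]/(primeNX (n:=k.+1)); [right|left].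
- transitivity (a * f ^+ k.+1 * g); first by ring.
  have -> : a * f ^+ k.+1 = g ^+ k * (f ^+ k - b * g).
    by rewrite mulrBr -exprMn [g * f]mulrC e !exprS; ring.
  by rewrite [g ^+ k.+1]exprS; ring.
have [||t ht] := @glue_fractions (b * f) (f ^+ k.+1) (g ^+ k - a * f) (g ^+ k.+1).
- by move=> p /cover[]/(primeNX (n:=k.+1)); [left|right].
- transitivity (b * g ^+ k.+1 * f); first by ring.
  have -> : b * g ^+ k.+1 = f ^+ k * (g ^+ k - a * f).
    by rewrite mulrBr -exprMn e !exprS; ring.
  by rewrite [f ^+ k.+1]exprS; ring.
exists s, t; apply: section_eq => p Up.
rewrite secD !secM !sec_constE -[RHS](rmorph1 (to_loc (prime_compl p))).
have [hs1 hs2] := hs p Up; have [ht1 ht2] := ht p Up.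
have [/(primeNX (n:=k.+1)) pf|/(primeNX (n:=k.+1)) pg] := cover p Up.
  apply: (to_loc_unit_cancel (s := f ^+ k.+1)) => //.
  rewrite mulrDr !mulrA hs2 ht1 -!rmorphM -rmorphD; congr to_loc.
  by rewrite !exprS; ring.
apply: (to_loc_unit_cancel (s := g ^+ k.+1)) => //.
rewrite mulrDr !mulrA hs1 ht2 -!rmorphM -rmorphD; congr to_loc.
by rewrite !exprS; ring.
Qed.

End Glue.

Section InverseMorphism.
Variables (S T : comPzRingType) (psi : {rmorphism S -> T}) (phi : T -> S).
Hypotheses (psiK : cancel psi phi) (phiK : cancel phi psi).

(** The cancellation proofs are arguments so that morphism structures can be attached to a map that
    is only known as an inverse. *)
Definition inverse_of of cancel psi phi & cancel phi psi := phi.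
Local Notation inv := (inverse_of psiK phiK).

Lemma inverse_zmod : zmod_morphism inv.
Proof. by move=> x y; apply: (can_inj psiK); rewrite rmorphB /= !phiK. Qed.

Lemma inverse_monoid : monoid_morphism inv.
Proof.
by split=> [|x y]; apply: (can_inj psiK); rewrite ?rmorph1 ?rmorphM /= !phiK.
Qed.

HB.instance Definition _ := GRing.isZmodMorphism.Build T S inv inverse_zmod.
HB.instance Definition _ := GRing.isMonoidMorphism.Build T S inv inverse_monoid.

Lemma rmorph_inverse : exists phi' : {rmorphism T -> S},
  cancel psi phi' /\ cancel phi' psi.
Proof. by exists inv. Qed.

End InverseMorphism.

(** * D(f, g) as the spectrum of its ring of functions *)

Section QuasiAffine.
Variables (A : comPzRingType) (U : set (Spec A)) (f g : A).
Hypothesis eU : U = nonzeros [set f; g].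
Hypothesis unit_sections :
  exists s t : section U, s * sec_const U f + t * sec_const U g = 1.
Let B := section U.
Let c : {rmorphism A -> B} := @sec_const A U.

Definition contract (q : Spec B) : Spec A := comap c q.

Lemma nonvanishing (q : Spec B) :
  ~ point_ideal q (c f) \/ ~ point_ideal q (c g).
Proof.
apply: contrapT => /not_orP[/contrapT qf /contrapT qg].
have [s [t e]] := unit_sections; apply: (@prime1 _ q); rewrite -e.
by apply: idealD; [exact: primeI|apply: idealMl => //; exact: primeI..].
Qed.

Lemma contractU q : U (contract q).
Proof. by rewrite eU; apply/nonzeros2; exact: nonvanishing. Qed.

(** One of [f] and [g] is outside [q], and [section_extend] applies to it. This comparison of [B]
    with [A] near [q] yields the injectivity of [contract], its topology and the isomorphisms of
    stalks. *)
Lemma clear_denominator (q : Spec B) (b : B) : exists h a,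
  ~ point_ideal q (c h) /\ c h * b = c a.
Proof.
have [qf|qg] := nonvanishing q.
  have [n [a e]] := section_extend b eU; exists (f ^+ n), a; split=> //.
  by rewrite rmorphXn; exact: primeNX.
have [|n [a e]] := @section_extend _ _ g f b; first by rewrite eU setUC.
by exists (g ^+ n), a; split=> //; rewrite rmorphXn; exact: primeNX.
Qed.

Lemma contract_sub q q' : contract q = contract q' -> point_ideal q `<=` point_ideal q'.
Proof.
move=> /(congr1 (@point_ideal A)) e b qb.
have [h [a [qh eb]]] := clear_denominator q' b.
have : point_ideal q (c a) by rewrite -eb; apply: idealMl => //; exact: primeI.
move=> qa; have : point_ideal (contract q) a by [].
by rewrite e /= -eb => /primeM[].
Qed.

Lemma contract_inj : injective contract.
Proof.
by move=> q q' e; apply: spec_eq; apply/seteqP; split; apply: contract_sub.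
Qed.

(** These are the sections whose value at [p] lies in the maximal ideal of the stalk; the prime is
    the preimage of [p] under [contract]. *)
Lemma extend_prime p (Up : U p) : prime_ideal
  [set b : B | exists a h, [/\ point_ideal p a, ~ point_ideal p h &
     to_loc (prime_compl p) h * b p Up = to_loc _ a]].
Proof.
have pI := primeI p; split; first split.
- by exists 0, 1; split; [exact: ideal0|exact: prime1|rewrite mulr0 rmorph0].
- move=> b b' [a [h [pa ph e]]] [a' [h' [pa' ph' e']]].
  exists (h' * a + h * a'), (h * h'); split; last 1 first.
  + rewrite secD !(rmorphM, rmorphD) /= -e -e'; ring.
  + by apply: idealD => //; apply: idealMl.
  + exact: primeNM.
- move=> b b' [a [h [pa ph e]]].
  have [d [k [Sk ek]]] := frac_surj (b p Up).
  exists (d * a), (k * h); split; [exact: idealMl|exact: primeNM|].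
  by rewrite secM ek !rmorphM /= -e mulrACA mkfrac_den.
- move=> [a [h [pa ph]]]; rewrite mulr1 => /eqP; rewrite -subr_eq0 -rmorphB.
  move=> /eqP/to_loc_eq0[u pu e]; apply: (primeNM pu ph).
  have -> : u * h = u * a by apply: subr0_eq; rewrite -mulrBr.
  exact: idealMl.
- move=> b b' [a [h [pa ph]]].
  have [d [k [Sk ek]]] := frac_surj (b p Up).
  have [d' [k' [Sk' ek']]] := frac_surj (b' p Up).
  move=> e; have : point_ideal p (d * d').
    have : to_loc (prime_compl p) (h * (d * d') - k * k' * a) = 0.
      rewrite rmorphB !rmorphM /= -e secM ek ek' -[to_loc _ d](mkfrac_den _ Sk).
      by rewrite -[to_loc _ d'](mkfrac_den _ Sk'); ring.
    move=> /to_loc_eq0[u pu]; rewrite mulrBr => /subr0_eq e'.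
    have [|//] : point_ideal p (u * h) \/ point_ideal p (d * d').
      by apply: primeM; rewrite -mulrA e'; do 2!apply: idealMl => //.
    by move=> /(primeNM pu ph).
  move=> /primeM[pd|pd']; [left; exists d, k|right; exists d', k']; split=> //.
    by rewrite ek mkfrac_den.
  by rewrite ek' mkfrac_den.
Qed.

Lemma contract_surj p : U p -> exists q, contract q = p.
Proof.
move=> Up; exists (SpecPoint (extend_prime Up)).
apply: spec_eq; apply/seteqP; split=> a /=.
  move=> [a' [h [pa' ph e']]].
  have /eqP : to_loc (prime_compl p) (h * a) = to_loc _ a'.
    by rewrite rmorphM; exact: e'.
  rewrite -subr_eq0 -rmorphB => /eqP/to_loc_eq0[u pu].
  rewrite mulrBr => /subr0_eq e.
  have : point_ideal p (u * (h * a)) by rewrite e; apply: idealMl => //; exact: primeI.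
  by move=> /primeM[//|/primeM[]].
by move=> pa; exists a, 1; split; [|exact: prime1|rewrite rmorph1 mul1r].
Qed.

Lemma contract_inverts p q : contract q = p ->
  inverts c (prime_compl p) (prime_compl q).
Proof. by move=> <- s qs; exists 1; rewrite mulr1. Qed.

(* The point [p] is kept apart from [contract q] to avoid casts between stalks. *)
Definition stalk_map p q (e : contract q = p) : stalk p -> stalk q :=
  loc_map (contract_inverts e).

Lemma stalk_map_frac p q (e : contract q = p) (a s : A)
    (ps : mul_set (prime_compl p) s) (qs : mul_set (prime_compl q) (c s)) :
  stalk_map e (mkfrac a ps) = mkfrac (c a) qs.
Proof.
have T : mul_set (prime_compl q) (c s * 1) by rewrite mulr1.
by rewrite /stalk_map (loc_mapE _ _ _ T); apply: frac_congr; ring.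
Qed.

Lemma stalk_map_inj p q (e : contract q = p) : injective (stalk_map e).
Proof.
move=> x y; have [a [s [ps ->]]] := frac_surj x.
have [b [t [pt ->]]] := frac_surj y.
have qs : mul_set (prime_compl q) (c s) by move: ps; rewrite -e.
have qt : mul_set (prime_compl q) (c t) by move: pt; rewrite -e.
rewrite (stalk_map_frac _ _ _ qs) (stalk_map_frac _ _ _ qt) => /fracE[u qu eu].
(* The factor [u] equating the two fractions lies in [B]; multiplied by [h] it becomes the image of
   an element [d] of [A] outside [p]. *)
have [h [d [qh ed]]] := clear_denominator q u.
pose r := d * (a * t - b * s).
have cr : c r = 0.
  rewrite /r rmorphM -ed rmorphB !rmorphM -mulrA mulrBr eu subrr mulr0 //.
have Up : U p by rewrite -e; exact: contractU.
have : to_loc (prime_compl p) r = 0 by rewrite -(sec_constE _ Up) [sec_const U r]cr.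
move=> /to_loc_eq0[v pv ev]; apply/fracE; exists (v * d).
  apply: primeNM => //; rewrite -e /= -ed; exact: primeNM.
by apply: subr0_eq; rewrite -[RHS]ev /r; ring.
Qed.

Lemma stalk_map_surj p q (e : contract q = p) (z : stalk q) :
  exists w, stalk_map e w = z.
Proof.
have [b [t [qt ->]]] := frac_surj z.
have [h [a [qh ea]]] := clear_denominator q b.
have [k [d [qk ed]]] := clear_denominator q t.
have qd : mul_set (prime_compl q) (c (d * h)).
  by rewrite rmorphM -ed; do 2?apply: primeNM.
have pd : mul_set (prime_compl p) (d * h) by rewrite -e.
(* From [b = a / h] and [t = d / k] one gets [b / t = a k / (d h)]. *)
exists (mkfrac (a * k) pd); rewrite (stalk_map_frac _ _ _ qd).
by apply: frac_congr; rewrite !rmorphM -ea -ed; ring.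
Qed.

Section Sections.
Variables (T : set (Spec A)) (V : set (Spec B)).
Hypotheses (TU : T `<=` U) (TV : forall q, V q <-> T (contract q)).

Lemma pull_locally_frac (s : section T) : locally_frac
  (fun q (Vq : V q) => stalk_map erefl (s (contract q) ((TV q).1 Vq))).
Proof.
move=> q Vq; have [a [h [qh hs]]] := section_basic s ((TV q).1 Vq).
exists (nonzeros [set c h]), (c a), (c h).
split; [exact: open_nonzeros|exact/nonzeros1|].
move=> q' Vq' /nonzeros1 qh'; exists qh'.
have /mkfracP -> := hs _ ((TV q').1 Vq') qh'.
exact: stalk_map_frac.
Qed.

Definition pull (s : section T) : section V := Section_ (pull_locally_frac s).

Lemma pull_zmod : zmod_morphism pull.
Proof. by move=> s t; apply: section_eq => q Vq; exact: raddfB. Qed.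

Lemma pull_monoid : monoid_morphism pull.
Proof.
by split=> [|s t]; apply: section_eq => q Vq; [exact: rmorph1|exact: rmorphM].
Qed.

HB.instance Definition _ :=
  GRing.isZmodMorphism.Build (section T) (section V) pull pull_zmod.
HB.instance Definition _ :=
  GRing.isMonoidMorphism.Build (section T) (section V) pull pull_monoid.

Lemma pull_inj : injective pull.
Proof.
move=> s t e; apply: section_eq => p Tp.
have [q eq] := contract_surj (TU Tp); subst p.
have Vq := (TV q).2 Tp.
rewrite (Prop_irrelevance Tp ((TV q).1 Vq)); apply: (@stalk_map_inj _ q erefl).
exact: (congr1 (fun s : section V => s q Vq) e).
Qed.

Lemma pull_surj (s : section V) : exists t, pull t = s.
Proof.
(* Quantifying over every [q] above [p], although there is only one, lets the chosen value be
   compared with [s] without casts between stalks. *)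
have ex p (Tp : T p) : exists w : stalk p,
    forall q (e : contract q = p) (Vq : V q), stalk_map e w = s q Vq.
  have [q eq] := contract_surj (TU Tp); subst p.
  have [w hw] := stalk_map_surj erefl (s q ((TV q).2 Tp)).
  exists w => q' e Vq'; have eq := contract_inj e; subst q'.
  by rewrite (Prop_irrelevance e erefl) hw (Prop_irrelevance Vq' ((TV q).2 Tp)).
pose v p Tp := sval (cid (ex p Tp)).
have vP p Tp q (e : contract q = p) (Vq : V q) : stalk_map e (v p Tp) = s q Vq.
  exact: (svalP (cid (ex p Tp))).
have lv : locally_frac v.
  move=> p Tp; have [q eq] := contract_surj (TU Tp); subst p.
  have [b [t [qt hb]]] := section_basic s ((TV q).2 Tp).
  have [h [a [qh ea]]] := clear_denominator q b.
  have [k [d [qk ed]]] := clear_denominator q t.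
  have qd : ~ point_ideal q (c (d * h)).
    by rewrite rmorphM -ed; do 2?apply: primeNM.
  exists (nonzeros [set d * h]), (a * k), (d * h).
  split; [exact: open_nonzeros|exact/nonzeros1|].
  move=> p Tp' /nonzeros1 pd; have [q' eq] := contract_surj (TU Tp'); subst p.
  have Vq' := (TV q').2 Tp'; have q'd : ~ point_ideal q' (c (d * h)) := pd.
  exists pd; apply: (@stalk_map_inj _ q' erefl).
  rewrite (vP _ _ _ _ Vq') (stalk_map_frac erefl _ _ q'd); apply/mkfracP.
  have q't : ~ point_ideal q' t.
    move=> q't; apply: q'd; rewrite rmorphM -ed.
    by apply: idealMr; [exact: primeI|apply: idealMl => //; exact: primeI].
  rewrite !rmorphM -ed -ea !rmorphM /= -(hb q' Vq' q't); ring.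
exists (Section_ lv); apply: section_eq => q Vq /=; exact: vP.
Qed.

Lemma pull_inverse : exists phi : {rmorphism section V -> section T},
  cancel pull phi /\ cancel phi pull.
Proof.
have [phi phiP] := choice pull_surj.
have pullK : cancel pull phi by move=> s; apply: pull_inj; rewrite phiP.
exact: (@rmorph_inverse _ _ pull phi pullK phiP).
Qed.

End Sections.

Lemma quasi_affine : affine (open_subscheme (spec_scheme A) U).
Proof.
exists B.
pose F (u : U) : Spec B := sval (cid (contract_surj (set_valP u))).
have FP u : contract (F u) = set_val u := svalP (cid (contract_surj (set_valP u))).
pose G (q : Spec B) : U := exist _ (contract q) (mem_set (contractU q)).
have FK : cancel F G by move=> u; apply: val_inj; exact: FP.
have GK : cancel G F by move=> q; apply: contract_inj; rewrite FP.
have TU (V : set (Spec B)) : set_val @` (F @^-1` V) `<=` U.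
  by move=> _ [u _ <-]; exact: set_valP.
have TV (V : set (Spec B)) q : V q <-> (set_val @` (F @^-1` V)) (contract q).
  split=> [Vq|[u Vu eq]]; first by exists (G q) => //; rewrite /= GK.
  suff -> : q = F u by [].
  by apply: contract_inj; rewrite FP eq.
pose phi V : {rmorphism section V -> section (set_val @` (F @^-1` V))} :=
  sval (cid (pull_inverse (@TU V) (TV V))).
have phiP V : cancel (pull (TV V)) (phi V) /\ cancel (phi V) (pull (TV V)) :=
  svalP (cid (pull_inverse (@TU V) (TV V))).
exists F, G, (fun V _ => phi V); split=> //.
- split; apply/continuousP => O [E eO].
    (* The preimage of [O] is the union over [good] of the D(a): if [b] in [E] is outside [F u],
       then [h b = a] for some [h] outside [F u], and D(a) contains the point and pulls back into
       D(b). *)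
    pose good := [set a | forall q, ~ point_ideal (contract q) a -> O q].
    exists (nonzeros good); first exact: open_nonzeros.
    apply/seteqP; split=> u /=.
      move=> /existsNP[a /not_implyP[ga ua]]; apply: ga; rewrite FP; exact: ua.
    rewrite eO => /existsNP[b /not_implyP[Eb qb]].
    have [h [a [qh ea]]] := clear_denominator (F u) b.
    move=> /(_ a) h'; apply: (primeNM qh qb); rewrite ea.
    have : point_ideal (set_val u) a.
      apply: h' => q qa; rewrite eO => hE; apply: qa.
      rewrite /= -ea; apply: idealMl; [exact: primeI|exact: hE].
    by rewrite -FP.
  move=> eO'; have [E' eE] := eO; rewrite -eO'.
  exists (c @` E'); rewrite eE; apply/seteqP; split=> q /= hq h'; apply: hq.
    by move=> a E'a; apply: h'; exists a.
  by move=> _ [a E'a <-]; exact: h'.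
- by move=> V oV; exists (pull (TV V)); have [] := phiP V.
- move=> V W oV oW WV s; have [_ K1] := phiP V; have [K2 K3] := phiP W.
  apply: (can_inj K2); rewrite K3; apply: section_eq => q Wq /=.
  rewrite -[in RHS](K1 s) /=.
  congr (stalk_map _ _); exact: congr1.
Qed.

End QuasiAffine.

(** * The three cases *)

(** A prime of [A] contains the image of [E] iff its contraction to [R] contains [E], that is,
    contains [m]. *)
Lemma nonzeros_ext_ideal (R : comPzRingType) (m : set R) (A : comPzRingType)
    (phi : {rmorphism R -> A}) (E : set R) : zeros E = zeros m ->
  nonzeros (phi @` E) = nonzeros (ext_ideal m phi).
Proof.
move=> Em; rewrite /nonzeros; congr (~` _); apply/seteqP; split=> p /= hp.
  move=> a; apply; first exact: primeI.
  move=> _ [r mr <-]; have : zeros E (comap phi p).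
    by move=> e Ee /=; apply: hp; exists e.
  by rewrite Em; apply.
move=> _ [e Ee <-]; have : zeros m (comap phi p).
  by move=> r mr; apply: hp; apply: sub_ideal_gen; exists r.
by rewrite -Em; apply.
Qed.

Lemma ideal_gen1 (A : comPzRingType) (e b : A) :
  ideal_gen [set e] b <-> exists a, b = a * e.
Proof.
split=> [h|[a ->]]; last first.
  by have [_ _ hM] := ideal_gen_ideal [set e]; apply: hM; exact: sub_ideal_gen.
apply: (h [set z | exists a, z = a * e]); last first.
  by move=> _ ->; exists 1; rewrite mul1r.
split=> [|_ _ [a ->] [a' ->]|a _ [a' ->]].
- by exists 0; rewrite mul0r.
- by exists (a + a'); rewrite mulrDl.
- by exists (a * a'); rewrite mulrA.
Qed.

Section StablePower.
Variables (A : comPzRingType) (y : A).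

Lemma stable_power_closed : stable_power y <-> closed (nonzeros [set y]).
Proof.
rewrite -openC; split=> [[k [a e]]|[E eE]].
  exists [set 1 - a * y]; apply/seteqP; split=> p.
    move=> /contrapT py; apply/nonzeros1 => p1.
    apply: (@prime1 _ p); rewrite -[1](subrK (a * y)).
    by apply: idealD => //; [exact: primeI|apply: idealMl; [exact: primeI|exact: py]].
  move=> /nonzeros1 p1 /nonzeros1 py; have : point_ideal p (y ^+ k * (1 - a * y)).
    have -> : y ^+ k * (1 - a * y) = y ^+ k - a * y ^+ k.+1 by rewrite exprS; ring.
    by rewrite -e subrr; apply: ideal0; exact: primeI.
  by move=> /primeM[/primeX|].
have hE : zeros E = nonzeros [set y].
  by rewrite -[RHS]setCK eE setCK.
have hI := ideal_gen_ideal E.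
have [i [r [Ei e1]]] : adjoin (ideal_gen E) y 1.
  apply: contrapT => n1.
  have [|p [Ip _]] := exists_prime_avoiding (f := 1) (adjoin_ideal y hI).
    by move=> n; rewrite expr1n.
  have : zeros E p.
    by move=> e Ee; apply: Ip; apply: sub_adjoin; exact: sub_ideal_gen.
  by rewrite hE => /nonzeros1; apply; apply: Ip; exact: adjoin_self.
(* Every prime contains [y] or lies in D(y) = V(E), and then contains [i]; hence [y i] is
   nilpotent. *)
have [N yi0] : exists N, (y * i) ^+ N = 0.
  apply: contrapT => /forallNP h.
  have [p [_ pyi]] := exists_prime_avoiding (zero_ideal A) h.
  have py : ~ point_ideal p y.
    by move=> py; apply: pyi; apply: idealMr => //; exact: primeI.
  have Ep : zeros E p by rewrite hE; apply/nonzeros1.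
  by apply: pyi; apply: idealMl; [exact: primeI|apply: Ei => //; exact: primeI].
(* Multiplied by [y^N], the identity [1 = (i + r y)^N] becomes [y^N = (y i)^N + w y^(N+1)], whose
   first term is zero. *)
have [w ew] : exists w, (i + r * y) ^+ N = i ^+ N + w * y.
  elim: (N) => [|n [w ew]]; first by exists 0; rewrite mul0r addr0.
  by exists (i * w + r * (i ^+ n + w * y)); rewrite !exprS ew; ring.
exists N, w; rewrite -[LHS]mulr1 -(expr1n A N) e1 ew mulrDr -exprMn yi0 exprS; ring.
Qed.

Lemma stable_power_surj : stable_power y <->
  forall z : loc (powers y), exists a, z = to_loc (powers y) a.
Proof.
split=> [[k [a e]] z|h]; last first.
  have [a /fracE[_ [N ->]]] := h (mkfrac 1 (powers_X y 1)).
  by rewrite !mulr1 expr1 => e; exists N, a; rewrite e exprS; ring.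
have [b [n ->]] := frac_powers z; exists (b * a ^+ n).
apply/fracE; exists (y ^+ k); first by exists k.
have ek : y ^+ k = a ^+ n * y ^+ (k + n).
  elim: n => [|n IH]; first by rewrite addn0 mul1r.
  rewrite {1}IH addnS -addSn [y ^+ (k + n)]exprD e [y ^+ (k.+1 + n)]exprD.
  by rewrite !exprS; ring.
by rewrite {1}ek exprD; ring.
Qed.

Lemma stable_powerNideal_gen : ~ stable_power y <->
  forall k, ~ ideal_gen [set y ^+ k.+1] (y ^+ k).
Proof.
split=> [h k /ideal_gen1[a e]|h [k [a e]]]; first by apply: h; exists k, a.
by apply: (h k); apply/ideal_gen1; exists a.
Qed.

End StablePower.

Section DimensionCases.
Variables (R : comPzRingType) (m : set R) (A : comPzRingType).
Variable phi : {rmorphism R -> A}.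
Hypothesis hm : local_ring_with m.

Lemma zeros_sub_max (E : set R) : zeros E = zeros m -> E `<=` m.
Proof.
move=> Em; have : zeros m (closed_point hm) by [].
by rewrite -Em.
Qed.

Lemma zeros_maximalP (p : Spec R) : zeros m p <-> point_ideal p = m.
Proof.
split=> [mp|/= e a ma]; last by rewrite /= e.
by apply/seteqP; split=> //; exact: local_prime_sub.
Qed.

Lemma local_spec_dim0 : krull_dim R 0 -> zeros m = setT.
Proof.
move=> [_ hd]; apply/seteqP; split=> // p _; apply/zeros_maximalP.
apply: contrapT => pm.
have pm' : point_ideal p `<` point_ideal (closed_point hm).
  split; first exact: local_prime_sub.
  by move=> mp; apply: pm; apply/zeros_maximalP.
have := hd 1%N (fun i => nth p [:: p; closed_point hm] i).
suff h : prime_chain (fun i : 'I_2 => nth p [:: p; closed_point hm] i) by move=> /(_ h).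
by move=> [[|[|i]] hi] [[|[|j]] hj].
Qed.

(** As [x] is in [m], [1 - a x] is a unit and [x^k = 0]. Then [x] lies in every prime, so every
    prime is [m], against the chain of two primes. *)
Lemma parameter_not_stable x : krull_dim R 1 -> zeros [set x] = zeros m ->
  ~ stable_power x.
Proof.
move=> [[c hc] _] xm [k [a e]].
have mx : m x by apply: (zeros_sub_max xm).
have xk : [set 0] (x ^+ k).
  apply: (local_unit_cancel hm (zero_ideal R) (r := 1 - a * x)).
    by apply: local_one_sub => //; apply: idealMl => //; exact: local_ideal.
  by rewrite /= mulrBl mul1r -mulrA -exprS -e subrr.
have p01 : point_ideal (c ord0) `<` point_ideal (c ord_max) by exact: hc.
have : zeros m (c ord0).
  rewrite -xm => _ ->; apply: (@primeX _ _ _ k); rewrite xk.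
  by apply: ideal0; exact: primeI.
move=> mc; have [_] := p01; apply; apply: subset_trans mc.
exact: local_prime_sub.
Qed.

Lemma range1 (T : Type) (x : 'I_1 -> T) : range x = [set x ord0].
Proof.
by apply/seteqP; split=> [_ [i _ <-]|_ ->]; [rewrite (ord1 i)|exists ord0].
Qed.

Lemma range2 (T : Type) (x : 'I_2 -> T) : range x = [set x ord0; x ord_max].
Proof.
apply/seteqP; split=> [_ [i _ <-]|_ [] ->]; [|by exists ord0|by exists ord_max].
by case: i => [[|[|//]] hi]; [left|right]; congr x; exact: val_inj.
Qed.

Lemma nonzeros_parameter1 (x : 'I_1 -> R) : parameters m x ->
  nonzeros [set phi (x ord0)] = nonzeros (ext_ideal m phi).
Proof. by move=> hx; rewrite -(nonzeros_ext_ideal phi hx) range1 image_set1. Qed.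

Lemma nonzeros_parameter2 (x : 'I_2 -> R) : parameters m x ->
  nonzeros (ext_ideal m phi) = nonzeros [set phi (x ord0); phi (x ord_max)].
Proof.
by move=> hx; rewrite -(nonzeros_ext_ideal phi hx) range2 image_setU !image_set1.
Qed.

Lemma parasolid_dim0 : krull_dim R 0 ->
  [<-> parasolid m phi 0; exists a : A, a <> 0; [set: Spec A] !=set0].
Proof.
move=> hd; tfae.
- move=> ps; pose x (i : 'I_0) : R := 0.
  have hx : parameters m x.
    rewrite /parameters local_spec_dim0 //; apply/seteqP; split=> // p _.
    by move=> r [[i hi]].
  exists 1; have := ps x hx; rewrite cech_map_paraclass => h A0.
  have /eqP : paraclass (phi \o x) != 0.
    apply: h; apply/eqP => /paraclass0_eq0 R0; apply: (local_one hm).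
    by rewrite R0; apply: ideal0; exact: local_ideal.
  by apply; apply/paraclass0_eq0.
- move=> [a a0]; have [|p _] := exists_prime_avoiding (f := 1) (zero_ideal A).
    move=> n; rewrite expr1n /= => A0; apply: a0.
    by rewrite -[a]mulr1 A0 mulr0.
  by exists p.
- move=> [p _] x hx _; rewrite cech_map_paraclass; apply/eqP => /paraclass0_eq0 A0.
  by apply: (@prime1 _ p); rewrite A0; apply: ideal0; exact: primeI.
Qed.

Lemma parasolid_dim1 (x : R) : krull_dim R 1 -> zeros [set x] = zeros m ->
  [<-> parasolid m phi 1;
       top_lc_nonzero m phi 1;
       ~ (forall z : loc (powers (phi x)),
            exists a : A, z = to_loc (powers (phi x)) a);
       ~ closed (nonzeros [set phi x])].
Proof.
move=> hd xm.
have xU : nonzeros [set phi x] = nonzeros (ext_ideal m phi).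
  by rewrite -(nonzeros_ext_ideal phi xm) image_set1.
(* D(x) = D(mA) does not depend on the parameter, so the relation transfers from one parameter to
   any other. *)
have stable_param (x' : 'I_1 -> R) : parameters m x' ->
    stable_power (phi (x' ord0)) <-> closed (nonzeros [set phi x]).
  by move=> hx'; rewrite stable_power_closed nonzeros_parameter1 // xU.
tfae.
- move=> ps; pose x' (i : 'I_1) := x.
  have hx' : parameters m x' by rewrite /parameters range1.
  exists x'; split=> //; exists (cech_map phi (paraclass x')); apply: ps => //.
  apply/eqP => /paraclass1_eq0; exact: parameter_not_stable.
- move=> [x' [hx' [c /eqP c0]]] /stable_power_surj/stable_power_closed h.
  by apply: c0; apply: stable_power_cech_eq0; apply/stable_param.
- by move=> h /stable_power_closed/stable_power_surj.
- move=> h x' hx' _; rewrite cech_map_paraclass; apply/eqP.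
  by move=> /paraclass1_eq0/(stable_param _ hx').
Qed.

(** The independent parameters supply a nonzero paraclass of [R] for the first implication. In the
    other two, a monomial relation links the vanishing of cohomology to affineness, for whichever
    parameters are at hand. *)
Lemma parasolid_dim2 : noetherian R -> krull_dim R 2 ->
  [<-> parasolid m phi 2;
       top_lc_nonzero m phi 2;
       ~ affine (open_subscheme (spec_scheme A)
                   (nonzeros (ext_ideal m phi)))].
Proof.
move=> hR hd; tfae.
- move=> ps; have [x [y [mx my xym nxy]]] := exists_independent_parameters hR hm hd.
  pose z (i : 'I_2) := if i == ord0 then x else y.
  have hz : parameters m z.
    rewrite /parameters range2; apply/seteqP; split=> p /= hp.
      by apply/zeros_maximalP; apply: xym; apply: hp; [left|right].
    by move=> _ [] ->; apply: hp.
  exists z; split=> //; exists (cech_map phi (paraclass z)); apply: ps => //.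
  by apply/eqP => /paraclass2_eq0.
- move=> [x [hx [c /eqP c0]]] /(affine_monomial_relation (nonzeros_parameter2 hx)) h.
  by apply: c0; apply: monomial_relation_cech_eq0.
- move=> h x hx _; rewrite cech_map_paraclass; apply/eqP => /paraclass2_eq0 e.
  have eU := nonzeros_parameter2 hx.
  exact/h/(quasi_affine eU)/(monomial_relation_unit_sections eU e).
Qed.

End DimensionCases.

Theorem proposition1p9 (R : comPzRingType) (m : set R) (d : nat)
    (A : comPzRingType) (phi : {rmorphism R -> A})
    (hR : noetherian R) (hm : local_ring_with m) (hd : krull_dim R d) :
  [/\ d = 0%N ->
        [<-> parasolid m phi d;
             exists a : A, a <> 0;
             [set: Spec A] !=set0],
      d = 1%N ->
        forall x : R, zeros [set x] = zeros m ->
        [/\ [<-> parasolid m phi d;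
                 top_lc_nonzero m phi d;
                 ~ (forall z : loc (powers (phi x)),
                      exists a : A, z = to_loc (powers (phi x)) a);
                 ~ closed (nonzeros [set phi x])],
            ~ (forall z : loc (powers (phi x)),
                 exists a : A, z = to_loc (powers (phi x)) a) <->
              (forall k : nat,
                 ~ ideal_gen [set phi x ^+ k.+1] (phi x ^+ k)) &
            nonzeros [set phi x] = nonzeros (ext_ideal m phi)] &
      d = 2%N ->
        [<-> parasolid m phi d;
             top_lc_nonzero m phi d;
             ~ affine (open_subscheme (spec_scheme A)
                         (nonzeros (ext_ideal m phi)))]].
Proof.
split=> [d0|d1 x xm|d2]; subst d; [exact: parasolid_dim0| |exact: parasolid_dim2].
split; first exact: parasolid_dim1.
- by rewrite -stable_power_surj; exact: stable_powerNideal_gen.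
- by rewrite -(nonzeros_ext_ideal phi xm) image_set1.
Qed.
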